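(* Let $U\subset\mathbb R^2$ be a bounded simply connected closed domain with smooth boundary, and let $\psi^{(1)}(u,t),\psi^{(2)}(u,t)$, $u\in U$, $t\ge0$, be two smooth solutions of $$\partial_t\psi=\mu(\nabla\psi)\sum_{i,j=1,2}\sigma_{i,j}(\nabla\psi)\,\frac{\partial^2\psi}{\partial u_i\partial u_j}$$ with the same (time-independent) boundary data on $\partial U$. Then $$\frac{d}{dt}\int_U\left(\psi^{(1)}(u,t)-\psi^{(2)}(u,t)\right)^2du=-2\int_U\left(\nabla\psi^{(1)}-\nabla\psi^{(2)}\right)\cdot\left(W(\nabla\psi^{(1)})-W(\nabla\psi^{(2)})\right)du\le 0 ,$$ where the functions $\mu,\sigma_{i,j},W$ are as in the context. In particular the $\mathbb L^2$ distance between $\psi^{(1)}(\cdot,t)$ and $\psi^{(2)}(\cdot,t)$ is non-increasing in $t$.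
   Context: Let $\mathbb T\subset\mathbb R^2$ be the open triangle with vertices $(0,0),(1,0),(0,1)$. For $\rho=(\rho_1,\rho_2)\in\mathbb T$: $$\sigma(\rho)=\frac1\pi\left[\Lambda(\pi\rho_1)+\Lambda(\pi\rho_2)+\Lambda(\pi(1-\rho_1-\rho_2))\right],\qquad \Lambda(\theta)=\int_0^\theta\ln(2\sin t)\,dt,$$ $\sigma_{i,j}=\partial^2\sigma/\partial\rho_i\partial\rho_j$, i.e. $\sigma_{i,i}(\rho)=\pi\cot(\pi\rho_i)+\pi\cot(\pi(1-\rho_1-\rho_2))$ and $\sigma_{1,2}(\rho)=\sigma_{2,1}(\rho)=\pi\cot(\pi(1-\rho_1-\rho_2))$; and $$\mu(\rho)=\frac1{2\pi}\frac{\sin(\pi\rho_1)\sin(\pi\rho_2)}{\sin(\pi(1-\rho_1-\rho_2))}.$$ The vector field $W=(W^{(1)},W^{(2)})$ on $\mathbb T$ is $$W^{(1)}(\rho_1,\rho_2)=-\frac1{2\pi}\cot(\pi(\rho_1+\rho_2))\sin^2(\pi\rho_2)-\frac{\rho_2}4+\frac1{4\pi}\sin(2\pi\rho_2),\qquad W^{(2)}(\rho_1,\rho_2)=W^{(1)}(\rho_2,\rho_1).$$ Throughout, a solution is a classical solution, $C^1$ on $U\times[0,\infty)$ ($U$ closed), with $\nabla\psi(u,t)=(\partial_{u_1}\psi,\partial_{u_2}\psi)(u,t)\in\mathbb T$ for all $u\in U$, $t\ge0$. *)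

(* Defs.v *)
From HB Require Import structures.
From mathcomp Require Import all_boot all_order all_algebra.
From mathcomp Require Import all_classical all_reals all_analysis.

Set Implicit Arguments.
Unset Strict Implicit.
Unset Printing Implicit Defensive.

Import Order.TTheory GRing.Theory Num.Theory.
Import numFieldNormedType.Exports.

Local Open Scope classical_set_scope.
Local Open Scope ring_scope.

Section Domains.
Context {R : realType}.

Definition path_connected_set (T : topologicalType) (A : set T) : Prop :=
  forall x y, A x -> A y -> exists gamma : R -> T,
    [/\ {within `[0, 1], continuous gamma},
        (forall s, s \in `[0, 1] -> A (gamma s)),
        gamma 0 = x & gamma 1 = y].

(* A loop is contractible when a homotopy of loops inside A, based at its
   endpoint, deforms it to the constant loop. *)
Definition contractible_loop (T : topologicalType) (A : set T)
    (gamma : R -> T) : Prop :=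
  exists H : R * R -> T,
    [/\ {within `[0, 1] `*` `[0, 1], continuous H},
        (forall s r, s \in `[0, 1] -> r \in `[0, 1] -> A (H (s, r))),
        (forall s, s \in `[0, 1] -> H (s, 0) = gamma s),
        (forall s, s \in `[0, 1] -> H (s, 1) = gamma 0) &
        (forall r, r \in `[0, 1] -> H (0, r) = gamma 0 /\ H (1, r) = gamma 0)].

Definition simply_connected_set (T : topologicalType) (A : set T) : Prop :=
  [/\ A !=set0, path_connected_set A &
      forall gamma : R -> T,
        {within `[0, 1], continuous gamma} ->
        (forall s, s \in `[0, 1] -> A (gamma s)) ->
        gamma 0 = gamma 1 ->
        contractible_loop A gamma].

(* The closure of a nonempty connected open set. *)
Definition closed_domain (T : topologicalType) (U : set T) : Prop :=
  exists Omega : set T,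
    [/\ open Omega, connected Omega, Omega !=set0 & U = closure Omega].

Definition smooth_fun (gamma : R -> R) : Prop :=
  forall n x, derivable (derive1n n gamma) x 1.

(* Near each boundary point, up to exchanging the coordinates (exch) and
   reversing the second one (flip), U is the region on or above the graph of
   a smooth function. *)
Definition smooth_boundary (U : set (R * R)) : Prop :=
  forall x, (U `\` U°) x ->
    exists (gamma : R -> R) (exch flip : bool) (r : R),
      [/\ smooth_fun gamma, 0 < r &
          forall y, ball x r y ->
            let: (a, b) := if exch then (y.2, y.1) else y in
            U y <-> 0 <= (-1) ^+ flip * (b - gamma a)].

End Domains.

Section Regularity.
Context {R : realType}.

(* C^1 up to the boundary, for a closed set Q: f is C^1 in the interior of Q,
   and f and its derivatives extend continuously to Q. In finite dimension,
   asking this for all directions v or for a basis is the same. *)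
Definition C1_on (V : normedModType R) (Q : set V) (f : V -> R) : Prop :=
  {within Q, continuous f} /\
  forall v : V,
    (forall z, Q° z -> derivable f z v) /\
    exists2 g : V -> R,
      {within Q, continuous g} & forall z, Q° z -> g z = 'D_v f z.

(* The continuous extension to Q of the derivative along v of f in the
   interior of Q; meant for f with C1_on Q f and Q the closure of its
   interior. *)
Definition derive_on (V : normedModType R) (Q : set V) (v : V) (f : V -> R)
    (z : V) : R :=
  lim ('D_v f w @[w --> within Q° (nbhs z)]).

(* l is the derivative at x of f restricted to D; it is one-sided when D is
   an interval with endpoint x. *)
Definition derivative_within (D : set R) (f : R -> R) (x l : R) : Prop :=
  (f y - f x) / (y - x) @[y --> within D x^'] --> l.

End Regularity.

Section Coefficients.
Context {R : realType}.
Implicit Types rho : (R * R)%type.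

Definition cot (x : R) : R := cos x / sin x.

Definition triangle : set (R * R) :=
  [set rho | [/\ 0 < rho.1, 0 < rho.2 & rho.1 + rho.2 < 1]].

Definition Lambda (theta : R) : R :=
  \int[lebesgue_measure]_(t in `[0, theta]) ln (2 * sin t).

Definition sigma rho : R :=
  pi^-1 * (Lambda (pi * rho.1) + Lambda (pi * rho.2)
           + Lambda (pi * (1 - rho.1 - rho.2))).

Definition basis2 (i : 'I_2) : (R * R)%type :=
  if i == ord0 then (1, 0) else (0, 1).

Definition sigma_ (i j : 'I_2) rho : R :=
  'D_(basis2 i) (fun r => 'D_(basis2 j) sigma r) rho.

Definition mu rho : R :=
  (2 * pi)^-1 * (sin (pi * rho.1) * sin (pi * rho.2)
                 / sin (pi * (1 - rho.1 - rho.2))).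

Definition W1 (rho1 rho2 : R) : R :=
  - ((2 * pi)^-1 * cot (pi * (rho1 + rho2)) * sin (pi * rho2) ^+ 2)
  - rho2 / 4 + (4 * pi)^-1 * sin (2 * pi * rho2).

Definition W rho : (R * R)%type := (W1 rho.1 rho.2, W1 rho.2 rho.1).

End Coefficients.

Section Equation.
Context {R : realType}.
Implicit Types (U : set (R * R)) (psi : (R * R) * R -> R).

Definition dotp (p q : R * R) : R := p.1 * q.1 + p.2 * q.2.

Definition spacetime U : set ((R * R) * R) := U `*` [set` `[0, +oo[].

Definition dir_x (i : 'I_2) : ((R * R) * R)%type := (basis2 i, 0).

Definition dir_t : ((R * R) * R)%type := (0, 1).

(* The gradient in u at (u, t), for all u in U and t >= 0, boundary included. *)
Definition nabla U psi (z : (R * R) * R) : (R * R)%type :=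
  (derive_on (spacetime U) (dir_x ord0) psi z,
   derive_on (spacetime U) (dir_x ord_max) psi z).

Definition second_x psi (i j : 'I_2) (z : (R * R) * R) : R :=
  'D_(dir_x i) (fun w => 'D_(dir_x j) psi w) z.

(* Classical solutions: C^1 up to the boundary (t = 0 included), C^2 in u in
   the interior, where the equation holds. *)
Record solution U psi : Prop := {
  solution_C1 : C1_on (spacetime U) psi ;
  solution_C2 : forall i j z, (spacetime U)° z ->
    derivable (fun w => 'D_(dir_x j) psi w) z (dir_x i) /\
    {for z, continuous (second_x psi i j)} ;
  solution_slope : forall z, spacetime U z -> triangle (nabla U psi z) ;
  solution_eq : forall z, (spacetime U)° z ->
    'D_dir_t psi z =
      mu (nabla U psi z) *
      \sum_(i < 2) \sum_(j < 2)
         sigma_ i j (nabla U psi z) * second_x psi i j z }.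

Definition plane_integral U (f : R * R -> R) : R :=
  \int[(@lebesgue_measure R \x @lebesgue_measure R)%E]_(u in U) f u.

Definition L2sq U psi1 psi2 (t : R) : R :=
  plane_integral U (fun u => (psi1 (u, t) - psi2 (u, t)) ^+ 2).

Definition L2dist U psi1 psi2 (t : R) : R := Num.sqrt (L2sq U psi1 psi2 t).

End Equation.

(* Main.v *)
Require Import Defs.
From HB Require Import structures.
From mathcomp Require Import all_boot all_order all_algebra.
From mathcomp Require Import all_classical all_reals all_analysis.
From mathcomp Require Import measurable_realfun.
From mathcomp Require Import ring lra.

Import Order.TTheory GRing.Theory Num.Theory.
Import numFieldNormedType.Exports.

Local Open Scope classical_set_scope.
Local Open Scope ring_scope.

Set Implicit Arguments.
Unset Strict Implicit.
Unset Printing Implicit Defensive.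

(** [w = psi1 - psi2] satisfies [w_t = div F] with [F = W(grad psi1) - W(grad psi2)],
    because the matrix [mu * sigma_ij] is the symmetric part of the Jacobian of [W] and
    second derivatives commute. Hence [d/dt int w^2 = 2 int w div F = - 2 int grad w . F],
    and [grad w . F >= 0] because [mu * sigma_ij] is positive definite on the triangle.

    The second derivatives of [psi1], [psi2] may blow up at the boundary of [U], so the
    integration by parts is done with a cutoff [phi_eps(w)] of [w] that vanishes for
    [|w| < eps]: since [w = 0] on the boundary, [phi_eps(w) F] extends by zero to a
    compactly supported field on the plane, whose divergence integrates to zero by Fubini.
    In the limit [eps -> 0] the set [w = 0] is lost, which is harmless because
    [grad w = 0] almost everywhere on it. *)

(** * Measure and integration in the plane *)

Section PlaneMeasure.
Context {R : realType}.
Local Notation P := (measurableTypeR R * measurableTypeR R)%type.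
Local Notation leb2 := ((@lebesgue_measure R \x @lebesgue_measure R)%E).

(** The limit [eps -> 0] can be taken because the equation identifies [div F] with [w_t], which is
    continuous on all of [U], although the two partial derivatives that make up [div F] may each be
    unbounded near the boundary. So each coordinate direction is treated for fixed [eps], where the
    cutoff hides the boundary, and only the sum is passed to the limit by dominated convergence.
    This forces the cutoff to be C^1 with a derivative bounded uniformly in [eps].

    Monotonicity of [W] rests on an explicit form. With [S1], [S2], [S] the sines of [pi rho_1],
    [pi rho_2], [pi (rho_1 + rho_2)] and [C] the cosine of the last angle, the quadratic form of
    [mu * sigma_ij] is [(S2^2 x^2 - 2 C S1 S2 x y + S1^2 y^2) / (2 S^2)], nonnegative because
    [C^2 <= 1].

    The equation is available only in the interior of space-time. The boundary of [U] is handled by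
    [w = 0], and the time [t = 0] by continuity of both sides. *)

Definition rational_ball (i : nat * (rat * rat)) : set (R * R) :=
  ball (ratr i.2.1 : R, ratr i.2.2 : R) i.1.+1%:R^-1.

Lemma rational_ball_basis (x : R * R) (A : set (R * R)) : nbhs x A ->
  exists2 i, rational_ball i x & rational_ball i `<=` A.
Proof.
move=> /nbhs_ballP[e /= e0 eA].
pose r (n : nat) : R := n.+1%:R^-1.
have /= [n ne] : exists n, r n < e / 2.
  have [n _ nP] := near_infty_natSinv_lt (PosNum (divr_gt0 e0 (ltr0n R 2))).
  by exists n; apply: (nP n) => /=.
have r0 : 0 < r n by rewrite invr_gt0.
have rx (y : R) : exists q : rat, ball (ratr q : R) (r n) y.
  have [|q] := @rat_in_itvoo R (y - r n) (y + r n); first by lra.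
  rewrite in_itv/= => /andP[? ?]; exists q.
  by rewrite /ball/= ltr_norml; apply/andP; split; lra.
have [q1 q1x] := rx x.1; have [q2 q2x] := rx x.2.
exists (n, (q1, q2)); first by split.
move=> y [/= y1 y2]; apply: eA.
have bl (u v w : R) : ball u (r n) v -> ball u (r n) w -> ball v e w.
  by move=> /ball_sym uv uw; apply: (le_ball (e1 := r n + r n));
    [rewrite -/(r n); lra | exact: ball_triangle uv uw].
by split; apply: bl; [exact: q1x| |exact: q2x|].
Qed.

Lemma measurable_rational_ball i : measurable (rational_ball i : set P).
Proof.
rewrite [rational_ball i](_ : _ = ball (ratr i.2.1 : R) i.1.+1%:R^-1 `*`
  ball (ratr i.2.2 : R) i.1.+1%:R^-1)//.
by apply: measurableX; apply: open_measurable; exact: ball_open.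
Qed.

(** The sigma-algebra of [P] is the product one, so openness yields measurability through a
    countable base of measurable squares. The union keeps exactly those base squares that lie inside
    [A]. *)
Lemma open_measurable_plane (A : set (R * R)) :
  open A -> measurable (A : set P).
Proof.
move=> oA.
have -> : (A : set P) =
    \bigcup_i (if `[< rational_ball i `<=` A >] then rational_ball i else set0).
  apply/seteqP; split => [x Ax|x [i _]]; last by case: asboolP => // + ?; apply.
  have [i ix iA] := rational_ball_basis (open_nbhs_nbhs (conj oA Ax)).
  by exists i => //; case: asboolP.
apply: countable_bigcupT_measurable => // i.
by case: asboolP => // _; exact: measurable_rational_ball.
Qed.

Lemma closed_measurable_plane (A : set (R * R)) :
  closed A -> measurable (A : set P).
Proof.
move=> cA; rewrite -(setCK A); apply: measurableC.
by apply: open_measurable_plane; rewrite openC.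
Qed.

Lemma within_continuous_measurable_plane (A : set (R * R)) (f : R * R -> R) :
  measurable (A : set P) -> {within A, continuous f} ->
  measurable_fun (A : set P) f.
Proof.
move=> mA /continuousP cf.
apply: (measurability _ (RGenOpens.measurableE R)) => //.
move=> _ [_ [a [b ->] <-]].
have /cf : open (`]a, b[%classic : set R) by exact: interval_open.
move=> /open_subspaceP[V oV VA].
rewrite setIC -VA; apply: measurableI => //.
exact: open_measurable_plane.
Qed.

Definition box (M : R) : set (R * R) := `[- M, M]%classic `*` `[- M, M]%classic.

Lemma measurable_box M : measurable (box M : set P).
Proof. exact: measurableX. Qed.

Lemma leb2_box_fin M : (leb2 (box M) < +oo)%E.
Proof.
rewrite product_measure1E//= !lebesgue_measure_itv/= !lte_fin.
by case: ifPn => _; rewrite ?mule0 ?mul0e ?ltry// -EFinB -EFinM ltry.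
Qed.

Lemma bounded_set_box (A : set (R * R)) : bounded_set A ->
  exists2 M : R, 0 < M & forall x, A x -> `|x.1| < M /\ `|x.2| < M.
Proof.
move=> [N [Nr AN]]; exists (`|N| + 2); first by rewrite ltr_wpDl.
move=> x Ax; have /(_ _ x Ax) := AN (`|N| + 1).
have -> // : N < `|N| + 1 by rewrite (le_lt_trans (ler_norm _))// ltrDl.
move=> /(_ isT) /=; rewrite prod_normE/= ge_max => /andP[x1 x2].
by split; [move: x1|move: x2]; move=> /le_lt_trans; apply; lra.
Qed.

Lemma sub_box (A : set (R * R)) (M : R) :
  (forall x, A x -> `|x.1| < M /\ `|x.2| < M) -> A `<=` box M.
Proof.
move=> AM x /AM[x1 x2].
by split; rewrite /= in_itv/= -ler_norml ltW.
Qed.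

Lemma bounded_closed_compact_plane (A : set (R * R)) :
  bounded_set A -> closed A -> compact A.
Proof.
move=> /bounded_set_box[M M0 /sub_box AM] cA.
apply: (subclosed_compact cA _ AM).
by apply: compact_setX; exact: segment_compact.
Qed.

Lemma leb2_bounded_fin (A : set (R * R)) : measurable (A : set P) ->
  bounded_set A -> (leb2 A < +oo)%E.
Proof.
move=> mA /bounded_set_box[M M0 /sub_box AM].
apply: le_lt_trans (leb2_box_fin M).
by apply: le_measure => //; rewrite inE//; exact: measurable_box.
Qed.

Lemma compact_measurable_plane (A : set (R * R)) : compact A ->
  measurable (A : set P).
Proof.
move=> cA; apply: closed_measurable_plane.
by apply: compact_closed => //; exact: norm_hausdorff.
Qed.

Lemma compact_within_bounded (A : set (R * R)) (f : R * R -> R) :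
  compact A -> {within A, continuous f} ->
  exists2 C : R, 0 < C & forall x, A x -> `|f x| <= C.
Proof.
move=> cA cf.
have /compact_bounded[C [_ fC]] := continuous_compact cf cA.
exists (`|C| + 1); first by rewrite ltr_wpDl.
move=> x Ax; apply: (fC (`|C| + 1)); last by exists x.
by rewrite (le_lt_trans (ler_norm _))// ltrDl.
Qed.

Lemma bounded_integrable_plane (A : set (R * R)) (f : R * R -> R) (C : R) :
  measurable (A : set P) -> bounded_set A ->
  measurable_fun (A : set P) f -> (forall x, A x -> `|f x| <= C) ->
  leb2.-integrable (A : set P) (EFin \o f).
Proof.
move=> mA bA mf fC; apply: measurable_bounded_integrable => //.
  exact: leb2_bounded_fin.
exists C; split; first exact: num_real.
by move=> D CD x Ax; exact: le_trans (fC _ Ax) (ltW CD).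
Qed.

Lemma within_continuous_integrable_plane (A : set (R * R)) (f : R * R -> R) :
  compact A -> {within A, continuous f} ->
  leb2.-integrable (A : set P) (EFin \o f).
Proof.
move=> cA cf; have [C _ fC] := compact_within_bounded cA cf.
have mA := compact_measurable_plane cA.
apply: bounded_integrable_plane fC => //; first exact: compact_bounded.
exact: within_continuous_measurable_plane.
Qed.

Lemma supported_integrable_plane (k : R * R -> R) (M : R) : continuous k ->
  (forall x, ~ box M x -> k x = 0) ->
  leb2.-integrable [set: P] (EFin \o k).
Proof.
move=> ck kM.
have -> : EFin \o k = (EFin \o k) \_ (box M).
  by apply/funext => x; rewrite patchE/=; case: ifPn => // /negP; rewrite inE => /kM ->.
apply/(integrable_mkcond _ (measurable_box M)).
apply: within_continuous_integrable_plane.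
  by apply: compact_setX; exact: segment_compact.
exact: continuous_subspaceT.
Qed.

Lemma integral_derive0 (h k : R -> R) (M : R) : 0 < M ->
  (forall x : R, is_derive x 1 h (k x)) -> continuous k ->
  (forall x, M <= `|x| -> h x = 0) -> (forall x, M < `|x| -> k x = 0) ->
  (\int[lebesgue_measure]_x (k x)%:E = 0)%E.
Proof.
move=> M0 hk ck h0 k0.
have -> : (\int[lebesgue_measure]_x (k x)%:E =
           \int[lebesgue_measure]_(x in `[(- M)%R, M]) (k x)%:E)%E.
  rewrite [RHS]integral_mkcond; apply: eq_integral => x _.
  rewrite patchE; case: ifPn => //; rewrite notin_setE/= in_itv/= -ler_norml.
  by move=> /negP; rewrite -ltNge => /k0 ->.
have ch : continuous h.
  move=> x; apply: differentiable_continuous; apply/derivable1_diffP.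
  by have [] := hk x.
rewrite (@continuous_FTC2 _ _ h).
- have -> : h M = 0 by apply: h0; exact: ler_norm.
  have -> : h (- M) = 0 by apply: h0; rewrite normrN; exact: ler_norm.
  by rewrite subee.
- by rewrite gtrN.
- exact: continuous_subspaceT.
- split.
  + by move=> x _; have [] := hk x.
  + by apply: cvg_at_right_filter; exact: ch.
  + by apply: cvg_at_left_filter; exact: ch.
- by move=> x _; rewrite derive1E; have [_ ->] := hk x.
Qed.

End PlaneMeasure.

(** * Derivatives along lines, and integrals of partial derivatives over the plane *)

Lemma continuous_pairl (T S : topologicalType) (y : S) :
  continuous (fun x : T => (x, y)).
Proof. by move=> x; apply: (cvg_pair (f := idfun) (g := fun=> y)); [exact: cvg_id|exact:
  cvg_cst]. Qed.

Lemma continuous_pairr (T S : topologicalType) (y : S) :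
  continuous (fun x : T => (y, x)).
Proof. by move=> x; apply: (cvg_pair (f := fun=> y) (g := idfun)); [exact: cvg_cst|exact:
  cvg_id]. Qed.

Section Lines.
Context {R : realType} {V : normedModType R}.

(** Both sides have literally the same difference quotient. This is the bridge by which one-variable
    calculus (chain rule, mean value theorem) is applied to directional derivatives. *)
Lemma is_derive_line (f : V -> R) (z v : V) (s l : R) :
  is_derive s 1 (fun r => f (z + r *: v)) l <-> is_derive (z + s *: v) v f l.
Proof.
have E : (fun h : R => h^-1 *: ((f \o shift (z + s *: v)) (h *: v) - f (z + s *: v)))
  = (fun h : R => h^-1 *: (((fun r => f (z + r *: v)) \o shift s) (h *: 1)
       - f (z + s *: v))).
  apply/funext => h /=; congr (_ *: (f _ - _)).
  by rewrite addrCA -scalerDl scaler1.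
have dE : 'D_1 (fun r : R => f (z + r *: v)) s = 'D_v f (z + s *: v) by rewrite /derive E.
have cE : derivable (fun r : R => f (z + r *: v)) s 1 = derivable f (z + s *: v) v.
  by rewrite /derivable E.
split=> -[d e]; apply: DeriveDef.
- exact: (eq_ind _ id d _ cE).
- exact: (etrans (esym dE) e).
- exact: (eq_ind _ id d _ (esym cE)).
- exact: (etrans dE e).
Qed.

End Lines.

Section PlaneDerive.
Context {R : realType}.
Local Notation P := (measurableTypeR R * measurableTypeR R)%type.
Local Notation leb2 := ((@lebesgue_measure R \x @lebesgue_measure R)%E).

Lemma pairE1 (x y : R) : (x, y) = (0, y) + x *: (1, 0) :> R * R.
Proof. by congr pair => /=; rewrite ?scaler0 ?scaler1 ?addr0 ?add0r. Qed.

Lemma pairE2 (x y : R) : (x, y) = (x, 0) + y *: (0, 1) :> R * R.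
Proof. by congr pair => /=; rewrite ?scaler0 ?scaler1 ?addr0 ?add0r. Qed.

Lemma is_derive_x (f : R * R -> R) (x y l : R) :
  is_derive (x, y) (1, 0) f l <-> is_derive x 1 (fun r => f (r, y)) l.
Proof.
rewrite {1}pairE1 -is_derive_line.
by under [X in is_derive _ _ X _]eq_fun do rewrite -pairE1.
Qed.

Lemma is_derive_y (f : R * R -> R) (x y l : R) :
  is_derive (x, y) (0, 1) f l <-> is_derive y 1 (fun r => f (x, r)) l.
Proof.
rewrite {1}pairE2 -is_derive_line.
by under [X in is_derive _ _ X _]eq_fun do rewrite -pairE2.
Qed.

Lemma integral_derive_x0 (h k : R * R -> R) (M : R) : 0 < M ->
  (forall x : R * R, is_derive x (1, 0) h (k x)) -> continuous k ->
  (forall x, ~ (`|x.1| < M /\ `|x.2| < M) -> h x = 0) ->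
  (forall x, ~ (`|x.1| < M /\ `|x.2| < M) -> k x = 0) ->
  (\int[leb2]_x (k x)%:E = 0)%E.
Proof.
move=> M0 hk ck h0 k0.
have ik : leb2.-integrable [set: P] (EFin \o k).
  apply: (supported_integrable_plane ck (M := M)) => x xM.
  by apply: k0 => /(@sub_box _ [set x | `|x.1| < M /\ `|x.2| < M]) H; exact/xM/H.
(* The inner integral runs in the direction of differentiation, so it already vanishes on every
   line. *)
rewrite -(integral21_prod_meas1 ik) /fubini_G; apply: integral0_eq => y _ /=.
apply: (@integral_derive0 _ (fun x => h (x, y)) (fun x => k (x, y)) M M0).
- by move=> x; exact: (is_derive_x _ _ _ _).1 (hk _).
- by move=> x; apply: (continuous_comp (f := fun x => (x, y))) (ck _); exact:
    continuous_pairl.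
- by move=> x xM; apply: h0 => -[/=]; rewrite ltNge xM.
- by move=> x xM; apply: k0 => -[/=]; rewrite ltNge ltW.
Qed.

Lemma integral_derive_y0 (h k : R * R -> R) (M : R) : 0 < M ->
  (forall x : R * R, is_derive x (0, 1) h (k x)) -> continuous k ->
  (forall x, ~ (`|x.1| < M /\ `|x.2| < M) -> h x = 0) ->
  (forall x, ~ (`|x.1| < M /\ `|x.2| < M) -> k x = 0) ->
  (\int[leb2]_x (k x)%:E = 0)%E.
Proof.
move=> M0 hk ck h0 k0.
have ik : leb2.-integrable [set: P] (EFin \o k).
  apply: (supported_integrable_plane ck (M := M)) => x xM.
  by apply: k0 => /(@sub_box _ [set x | `|x.1| < M /\ `|x.2| < M]) H; exact/xM/H.
rewrite -(integral12_prod_meas1 ik) /fubini_F; apply: integral0_eq => y _ /=.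
apply: (@integral_derive0 _ (fun x => h (y, x)) (fun x => k (y, x)) M M0).
- by move=> x; exact: (is_derive_y _ _ _ _).1 (hk _).
- by move=> x; apply: (continuous_comp (f := fun x => (y, x))) (ck _); exact:
    continuous_pairr.
- by move=> x xM; apply: h0 => -[/= _]; rewrite ltNge xM.
- by move=> x xM; apply: k0 => -[/= _]; rewrite ltNge ltW.
Qed.

End PlaneDerive.

(** * Null sets *)

(** A zero with nonzero derivative is isolated among the zeros of [f], so some interval with
    rational endpoints contains it and no other zero. Sending each point of [S] to such a pair of
    rationals is injective. *)
Lemma transversal_zeros_countable {R : realType} (f l : R -> R) (S : set R) :
  (forall x : R, S x -> [/\ f x = 0, l x != 0 & is_derive x 1 f (l x)]) ->
  countable S.
Proof.
move=> Sf.
have /choice[q qP] : forall x, exists q : rat * rat, S x ->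
    ratr q.1 < x < ratr q.2 /\
    forall y, ratr q.1 < y < ratr q.2 -> f y = 0 -> y = x.
  move=> x; have [Sx|nSx] := pselect (S x); last by exists (0, 0).
  have [fx0 lx0 [dfx fxl]] := Sf _ Sx.
  have lx : h^-1 *: ((f \o shift x) (h *: 1) - f x) @[h --> 0^'] --> l x.
    by rewrite -fxl; exact: dfx.
  have /= : \forall h \near 0^', h^-1 *: ((f \o shift x) (h *: 1) - f x) != 0.
    exact: cvgr_neq0 _ lx lx0.
  move=> /nbhs_ballP[e /= e0 eP].
  have [q1] := @rat_in_itvoo R (x - e) x (ltac:(lra)).
  rewrite in_itv/= => /andP[q1a q1b].
  have [q2] := @rat_in_itvoo R x (x + e) (ltac:(lra)).
  rewrite in_itv/= => /andP[q2a q2b].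
  exists (q1, q2) => _; split => /=; first by rewrite q1b.
  move=> y /andP[y1 y2] fy0; apply: contrapT => /eqP yx.
  have : ball 0 e (y - x).
    by rewrite -ball_normE/= sub0r normrN ltr_norml; apply/andP; split; lra.
  move=> /eP; rewrite subr_eq0 => /(_ yx).
  by rewrite /= scaler1 subrK fy0 fx0 subrr scaler0 eqxx.
apply/sub_countable/(countableP [set: rat * rat]).
apply/pcard_injP; exists q => // x y; rewrite !inE => Sx Sy qxy.
have [_ + ] := qP _ Sy; have [+ _] := qP _ Sx.
by rewrite qxy => xq /(_ _ xq); apply; have [] := Sf _ Sx.
Qed.

Section NullSets.
Context {R : realType}.
Local Notation P := (measurableTypeR R * measurableTypeR R)%type.
Local Notation leb := (@lebesgue_measure R).
Local Notation leb2 := ((@lebesgue_measure R \x @lebesgue_measure R)%E).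

Lemma countable_negligible_bigcup d (T : measurableType d)
    (m : {measure set T -> \bar R}) (I : countType) (F : I -> set T) :
  (forall i, m.-negligible (F i)) -> m.-negligible (\bigcup_i F i).
Proof.
move=> F0; pose G n := if unpickle n is Some i then F i else set0.
apply: (@negligibleS _ _ _ _ (\bigcup_n G n)).
  by move=> x [i _ Fix]; exists (pickle i) => //; rewrite /G pickleK.
apply: negligible_bigcup => n; rewrite /G; case: unpickle => //.
exact: negligible_set0.
Qed.

Lemma xsection_null (A : set P) : measurable A ->
  (forall x, leb (xsection A x) = 0%E) -> leb2 A = 0%E.
Proof. by move=> mA A0; apply: integral0_eq => x _ /=. Qed.

(** The product measure is defined by integrating over [x]-sections; uniqueness of the product
    measure replaces it by the one that integrates over [y]-sections. *)
Lemma ysection_null (A : set P) : measurable A ->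
  (forall x, leb (ysection A x) = 0%E) -> leb2 A = 0%E.
Proof.
move=> mA A0.
rewrite (@product_measure_unique _ _ _ _ _ leb leb (product_measure2 leb leb))//.
  by apply: integral0_eq => x _ /=.
by move=> B C mB mC; exact: product_measure2E.
Qed.

Lemma ysection_countable_null (A : set P) : measurable A ->
  (forall y, countable [set x | A (x, y)]) -> leb2 A = 0%E.
Proof.
move=> mA cA; apply: ysection_null => // y.
by rewrite [ysection _ _](_ : _ = [set x | A (x, y)]) ?countable_lebesgue_measure0//;
  apply/seteqP; split=> x; rewrite /ysection/= inE.
Qed.

Lemma xsection_countable_null (A : set P) : measurable A ->
  (forall x, countable [set y | A (x, y)]) -> leb2 A = 0%E.
Proof.
move=> mA cA; apply: xsection_null => // x.
by rewrite [xsection _ _](_ : _ = [set y | A (x, y)]) ?countable_lebesgue_measure0//;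
  apply/seteqP; split=> y; rewrite /xsection/= inE.
Qed.

Definition graph (gamma : R -> R) (exch : bool) : set (R * R) :=
  [set y | let: (a, b) := if exch then (y.2, y.1) else y in b = gamma a].

Lemma graph_null (gamma : R -> R) exch : continuous gamma ->
  measurable (graph gamma exch : set P) /\ leb2 (graph gamma exch) = 0%E.
Proof.
move=> cg.
have cg1 : continuous (fun y : R * R => y.2 - gamma y.1).
  move=> y; apply: cvgB; first exact: cvg_snd.
  by apply: (continuous_comp (f := fst) (g := gamma)); [exact: cvg_fst|exact: cg].
have cg2 : continuous (fun y : R * R => y.1 - gamma y.2).
  move=> y; apply: cvgB; first exact: cvg_fst.
  by apply: (continuous_comp (f := snd) (g := gamma)); [exact: cvg_snd|exact: cg].
have mg : measurable (graph gamma exch : set P).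
  apply: closed_measurable_plane; rewrite /graph; case: exch => /=.
    rewrite [X in closed X](_ : _ = (fun y : R * R => y.1 - gamma y.2) @^-1` [set 0]).
      by apply: closed_comp; [move=> y _; exact: cg2|exact: closed_eq].
    by apply/seteqP; split => -[a b] /=; [move=> ->; rewrite subrr|move/eqP;
      rewrite subr_eq0 => /eqP].
  rewrite [X in closed X](_ : _ = (fun y : R * R => y.2 - gamma y.1) @^-1` [set 0]).
    by apply: closed_comp; [move=> y _; exact: cg1|exact: closed_eq].
  by apply/seteqP; split => -[a b] /=; [move=> ->; rewrite subrr|move/eqP;
    rewrite subr_eq0 => /eqP].
split => //; case: exch mg => mg.
  apply: ysection_countable_null => // y.
  by rewrite [X in countable X](_ : _ = [set gamma y]); [exact: countable1|].
apply: xsection_countable_null => // x.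
by rewrite [X in countable X](_ : _ = [set gamma x]); [exact: countable1|].
Qed.

(** Near a boundary point the boundary lies in a graph, which is null. To pass from local to global,
    the boundary is covered by the countably many rational balls in which its trace is negligible;
    indexing by that property avoids choosing a chart for each ball. *)
Lemma smooth_boundary_null (U : set (R * R)) : smooth_boundary U ->
  leb2.-negligible (U `\` U° : set P).
Proof.
move=> sU.
have -> : (U `\` U° : set P) = \bigcup_i
    (if `[< leb2.-negligible ((U `\` U°) `&` rational_ball i : set P) >]
     then (U `\` U°) `&` rational_ball i else set0).
  apply/seteqP; split => [x Ux|x [i _]]; last by case: asboolP => // _ [].
  have [gamma [exch [flip [r [sg r0 rU]]]]] := sU _ Ux.
  have cg : continuous gamma.
    move=> a; apply: differentiable_continuous; apply/derivable1_diffP.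
    exact: (sg 0%N a).
  have [i ix ir] := rational_ball_basis (nbhsx_ballx x _ r0).
  exists i => //; case: asboolP => //; case.
  have [mg g0] := graph_null exch cg.
  exists (graph gamma exch); split => // y [[Uy nUy] /ir yr].
  apply: contrapT => yg; apply: nUy.
  pose F (y : R * R) := if exch then y.1 - gamma y.2 else y.2 - gamma y.1.
  have cF : continuous F.
    rewrite /F; case: (exch) => z.
      apply: cvgB; first exact: cvg_fst.
      by apply: (continuous_comp (f := snd) (g := gamma)); [exact: cvg_snd|exact: cg].
    apply: cvgB; first exact: cvg_snd.
    by apply: (continuous_comp (f := fst) (g := gamma)); [exact: cvg_fst|exact: cg].
  have UF z : ball x r z -> U z <-> 0 <= (-1) ^+ flip * F z.
    by move=> /rU; rewrite /F; case: (exch); case: z.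
  (* A point of [U] off the graph satisfies the defining inequality strictly; strictness persists
     nearby, so the point would be interior to [U]. *)
  have Fy : 0 < (-1) ^+ flip * F y.
    rewrite lt_neqAle; apply/andP; split; last by apply/(UF _ yr).
    rewrite eq_sym mulf_neq0 ?signr_eq0//; apply: contra_not_neq yg => /eqP.
    by rewrite /F /graph; case: (exch); case: (y) => a b /=; rewrite subr_eq0 => /eqP.
  have : \forall z \near y, 0 < (-1) ^+ flip * F z.
    by apply: (cvgr_gt _ (_ : (fun z => (-1) ^+ flip * F z) @ y --> (-1) ^+ flip * F y)) Fy;
      apply: cvgM; [exact: cvg_cst|exact: cF].
  have yb : \forall z \near y, ball x r z.
    by apply: open_nbhs_nbhs; split => //; exact: ball_open.
  by apply: filterS2 yb => z bz Fz; apply/UF => //; exact: ltW.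
apply: countable_negligible_bigcup => i; case: asboolP => // _.
exact: negligible_set0.
Qed.

End NullSets.

(** * A family of cutoffs *)

Section DirectionalDerivatives.
Context {R : realType} {V : normedModType R}.

Lemma is_derive_dir0 (f : V -> R) (x v : V) (l : R) :
  is_derive x v f l <-> is_derive (0 : R) 1 (fun r => f (x + r *: v)) l.
Proof. by rewrite is_derive_line scale0r addr0. Qed.

(** Restricting to the line through [x] reduces this to the one-variable chain rule, so a derivative
    of [w] in the single direction [v] suffices. *)
Lemma is_derive_comp (phi : R -> R) (w : V -> R) (x v : V) (dl l : R) :
  is_derive (w x) 1 phi dl -> is_derive x v w l ->
  is_derive x v (phi \o w) (dl * l).
Proof.
move=> hp /is_derive_dir0 hw; apply/is_derive_dir0.
have hp' : is_derive (w (x + 0 *: v)) 1 phi dl by rewrite scale0r addr0.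
by have := @is_derive1_comp _ phi (fun r : R => w (x + r *: v)) 0 _ _ hp' hw.
Qed.

End DirectionalDerivatives.

Section Cutoff.
Context {R : realType}.
Implicit Types (eps x : R).

(** The positive part enters the cutoff squared precisely to be C^1 across its zero. At [0] the
    Caratheodory slope function is the positive part itself. *)
Lemma is_derive_sqr_pos x :
  is_derive x 1 (fun y : R => (Num.max y 0) ^+ 2) (2 * Num.max x 0).
Proof.
have [x0|x0|->] := ltgtP x 0.
- rewrite mulr0; apply: (near_eq_is_derive (f := cst 0)) => //.
  near=> y; have y0 : y < 0 by near: y; exact: lt_nbhsl.
  by rewrite (max_idPr (ltW y0)) expr0n.
- apply: (near_eq_is_derive (f := fun y : R => y ^+ 2)).
    near=> y; have y0 : 0 < y by near: y; exact: lt_nbhsr.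
    by rewrite (max_idPl (ltW y0)).
  by apply: is_derive_eq; rewrite /= /GRing.scale/=; ring.
- rewrite mulr0; apply/is_derive1_caratheodory.
  exists (fun y => Num.max y 0); split => //.
  + by move=> z; rewrite ?maxxx; have [z0|z0] := leP z 0; ring.
  + have := @continuous_max R R idfun (cst 0) 0; apply; [exact: cvg_id|exact: cvg_cst].
  + by rewrite ?maxxx.
Unshelve. all: by end_near. Qed.

(* C^1 in [x], zero for [|x| <= eps]; as [eps -> 0] it tends to [x], its derivative
   staying bounded and tending to 1 away from [x = 0]. *)
Definition cutoff eps x : R :=
  (Num.max (x ^+ 2 - eps ^+ 2) 0) ^+ 2 * (x / (x ^+ 2 + eps ^+ 2) ^+ 2).

Definition dcutoff eps x : R :=
  let p := Num.max (x ^+ 2 - eps ^+ 2) 0 in let D := x ^+ 2 + eps ^+ 2 in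
  (4 * x ^+ 2 * p * D + p ^+ 2 * (D - 4 * x ^+ 2)) / D ^+ 3.

Lemma is_derive_cutoff eps x : 0 < eps -> is_derive x 1 (cutoff eps) (dcutoff eps x).
Proof.
move=> e0; have D0 (y : R) : y ^+ 2 + eps ^+ 2 != 0.
  by rewrite gt_eqF// ltr_wpDl ?sqr_ge0// exprn_gt0.
have h1 : is_derive x 1 (fun y : R => y ^+ 2 - eps ^+ 2) (2 * x).
  by apply: is_derive_eq; rewrite /= /GRing.scale/=; ring.
have h2 := @is_derive1_comp _ _ _ x _ _ (is_derive_sqr_pos _) h1.
have h3 : is_derive x 1 (fun y : R => (y ^+ 2 + eps ^+ 2) ^+ 2)
    (4 * x * (x ^+ 2 + eps ^+ 2)).
  by apply: is_derive_eq; rewrite /= /GRing.scale/=; ring.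
have h4 := @is_deriveV _ (fun y : R => (y ^+ 2 + eps ^+ 2) ^+ 2) x _ 1
  (expf_neq0 2 (D0 x)) h3.
have h5 := is_deriveM (is_derive_id x 1) h4.
have h6 := is_deriveM h2 h5.
apply: is_derive_eq; rewrite ?fctE /dcutoff /= /GRing.scale/=.
by field; exact: D0.
Qed.

Lemma cutoff_small eps x : 0 < eps -> `|x| < eps -> cutoff eps x = 0 /\ dcutoff eps x = 0.
Proof.
move=> e0 xe.
have p0 : Num.max (x ^+ 2 - eps ^+ 2) 0 = 0.
  apply/max_idPr; rewrite subr_le0 -[x ^+ 2]real_normK ?num_real//.
  by rewrite ler_sqr ?nnegrE ?(ltW e0) ?(ltW xe) ?normr_ge0.
by rewrite /cutoff /dcutoff p0; split; rewrite ?expr0n/= ?mulr0 ?mul0r ?addr0 ?mul0r.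
Qed.

(** With [D = x^2 + eps^2] and [p] the positive part of [x^2 - eps^2], the ratios [a = x^2 / D] and
    [b = p / D] lie in [[0, 1]]. Written in [a] and [b], the cutoff and its derivative no longer
    mention [eps], which makes the bounds below uniform. *)
Lemma cutoff_ratios eps x : 0 < eps ->
  exists a b : R, [/\ 0 <= a <= 1, 0 <= b <= 1, cutoff eps x = b ^+ 2 * x &
     dcutoff eps x = 4 * a * b + b ^+ 2 * (1 - 4 * a)].
Proof.
move=> e0; set p := Num.max (x ^+ 2 - eps ^+ 2) 0; set D := x ^+ 2 + eps ^+ 2.
have e20 : 0 < eps ^+ 2 by rewrite exprn_gt0.
have x20 : 0 <= x ^+ 2 by exact: sqr_ge0.
have D0 : 0 < D by rewrite ltr_wpDl.
have p0 : 0 <= p by rewrite le_max lexx orbT.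
have pD : p <= D by rewrite ge_max; apply/andP; split; rewrite /D; lra.
exists (x ^+ 2 / D), (p / D); split.
- by rewrite (divr_ge0 x20 (ltW D0))/= ler_pdivrMr// mul1r /D lerDl (ltW e20).
- by rewrite (divr_ge0 p0 (ltW D0))/= ler_pdivrMr// mul1r.
- by rewrite /cutoff -/p -/D; field; rewrite gt_eqF.
- by rewrite /dcutoff -/p -/D; field; rewrite gt_eqF.
Qed.

Lemma cutoff_le eps x : 0 < eps -> `|cutoff eps x| <= `|x|.
Proof.
move=> /cutoff_ratios-/(_ x)[a [b [_ /andP[b0 b1] -> _]]].
by rewrite normrM ger0_norm ?exprn_ge0// ler_piMl// exprn_ile1.
Qed.

(** The terms [4ab], [b^2] and [-4ab^2] lie in [[0, 4]], [[0, 1]] and [[-4, 0]]. The value 8 is not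
    sharp; only its independence of [eps] matters. *)
Lemma dcutoff_le eps x : 0 < eps -> `|dcutoff eps x| <= 8.
Proof.
move=> /cutoff_ratios-/(_ x)[a [b [/andP[a0 a1] /andP[b0 b1] _ ->]]].
have ab0 : 0 <= a * b by exact: mulr_ge0.
have ab1 : a * b <= 1 by rewrite mulr_ile1.
have b20 : 0 <= b ^+ 2 by exact: sqr_ge0.
have b21 : b ^+ 2 <= 1 by rewrite exprn_ile1.
have ab20 : 0 <= b ^+ 2 * a by exact: mulr_ge0.
have ab21 : b ^+ 2 * a <= 1 by rewrite mulr_ile1.
by rewrite ler_norml; apply/andP; split; lra.
Qed.

(** Joint continuity in [(eps, x)] away from the origin serves twice: for fixed [eps > 0] it gives
    continuity in [x], and at [(0, x)] with [x != 0], where the formulas evaluate to [x] and [1], it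
    gives the limit as [eps] tends to [0]. *)
Lemma continuous_cutoff2 (z : R * R) : z.2 ^+ 2 + z.1 ^+ 2 != 0 ->
  {for z, continuous (fun z => cutoff z.1 z.2)} /\
  {for z, continuous (fun z => dcutoff z.1 z.2)}.
Proof.
move=> z0.
have c1 : (y.1 ^+ 2) @[y --> z] --> z.1 ^+ 2.
  by apply: (continuous_comp (f := fst) (g := fun x : R => x ^+ 2));
    [exact: cvg_fst|exact: exprn_continuous].
have c2 : (y.2) @[y --> z] --> z.2 by exact: cvg_snd.
have c22 : (y.2 ^+ 2) @[y --> z] --> z.2 ^+ 2.
  by apply: (continuous_comp (f := snd) (g := fun x : R => x ^+ 2));
    [exact: cvg_snd|exact: exprn_continuous].
have cD : (y.2 ^+ 2 + y.1 ^+ 2) @[y --> z] --> z.2 ^+ 2 + z.1 ^+ 2.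
  exact: cvgD.
have cp : Num.max (y.2 ^+ 2 - y.1 ^+ 2) 0 @[y --> z] -->
    Num.max (z.2 ^+ 2 - z.1 ^+ 2) 0.
  have := @continuous_max R (R * R)%type (fun y :
    R * R => y.2 ^+ 2 - y.1 ^+ 2) (cst 0) z; apply.
    exact: cvgB.
  exact: cvg_cst.
have cX n (f : R * R -> R) : f y @[y --> z] --> f z ->
    (f y ^+ n) @[y --> z] --> f z ^+ n.
  by move=> cf; apply: (continuous_comp (f := f) (g := fun x : R => x ^+ n));
    [exact: cf|exact: exprn_continuous].
have cDn n : ((y.2 ^+ 2 + y.1 ^+ 2) ^+ n)^-1 @[y --> z] -->
    ((z.2 ^+ 2 + z.1 ^+ 2) ^+ n)^-1.
  by apply: cvgV; [exact: expf_neq0|exact: cX].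
have cp2 := cX 2%N _ cp.
split.
  by rewrite /cutoff; apply: cvgM => //; apply: cvgM => //; exact: cDn.
rewrite /dcutoff; apply: cvgM; last exact: cDn.
have c4 : (4 * y.2 ^+ 2) @[y --> z] --> 4 * z.2 ^+ 2.
  by apply: cvgM => //; exact: cvg_cst.
apply: cvgD; first by apply: cvgM => //; exact: cvgM.
by apply: cvgM => //; exact: cvgB.
Qed.

Lemma continuous_cutoff eps : 0 < eps -> continuous (cutoff eps) /\ continuous (dcutoff
  eps).
Proof.
move=> e0; split=> x;
  have [|c1 c2] := @continuous_cutoff2 (eps, x); rewrite /= ?gt_eqF//
    ?ltr_wpDl ?sqr_ge0// ?exprn_gt0//.
- apply: (@continuous_comp _ _ _ (fun x : R => (eps, x)) (fun z => cutoff z.1 z.2) x) c1;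
    exact: continuous_pairr.
- apply: (@continuous_comp _ _ _ (fun x : R => (eps, x)) (fun z => dcutoff z.1 z.2) x)
    c2; exact: continuous_pairr.
Qed.

Lemma cutoff_cvg x (u : R^nat) : u @ \oo --> 0 -> x != 0 ->
  cutoff (u n) x @[n --> \oo] --> x /\ dcutoff (u n) x @[n --> \oo] --> (1 : R).
Proof.
move=> u0 x0.
have [|c1 c2] := @continuous_cutoff2 (0, x).
  by rewrite /= expr0n/= addr0 expf_neq0.
have px : Num.max (x ^+ 2) 0 = x ^+ 2 by apply/max_idPl; exact: sqr_ge0.
have e1 : cutoff 0 x = x.
  by rewrite /cutoff expr0n/= subr0 addr0 px; field.
have e2 : dcutoff 0 x = 1.
  by rewrite /dcutoff expr0n/= subr0 addr0 px; field.
have cu : (u n, x) @[n --> \oo] --> ((0 : R), x).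
  by apply: (@cvg_pair _ _ _ _ (nbhs (0 : R)) (nbhs x) _ _ _ u (fun=> x)) => /=; [exact:
    u0|exact: cvg_cst].
split.
- by rewrite -{2}e1; apply: (cvg_comp _ _ cu c1).
- by rewrite -e2; apply: (cvg_comp _ _ cu c2).
Qed.

End Cutoff.

Lemma within_continuous_interior {R : realType} {T : topologicalType} (A : set T)
    (f : T -> R) x : {within A, continuous f} -> A° x -> {for x, continuous f}.
Proof.
move=> /subspace_continuousP cf Ax; have := cf x (interior_subset Ax).
by rewrite within_interior.
Qed.

(** * The cut-off flux, extended by zero to the plane *)

Section CutoffDivergence.
Context {R : realType}.
Local Notation P := (measurableTypeR R * measurableTypeR R)%type.
Local Notation leb2 := ((@lebesgue_measure R \x @lebesgue_measure R)%E).
Variables (U : set (R * R)) (w : R * R -> R).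
Hypothesis U_closed : closed U.
Hypothesis cw : {within U, continuous w}.
Hypothesis w0 : forall x, (U `\` U°) x -> w x = 0.

Lemma vanishing_near (eps : R) (x : R * R) : 0 < eps -> ~ U° x ->
  \forall y \near x, U° y -> `|w y| < eps.
Proof.
move=> e0 Ux; have [Wx|nUx] := pselect (U x).
  have /subspace_continuousP/(_ x Wx) := cw.
  have e0' : `|w x| < eps by rewrite (w0 (conj Wx Ux)) normr0.
  move=> /cvgr_norm_lt/(_ _ e0'); rewrite near_withinE.
  by apply: filterS => y H /interior_subset /H.
have : nbhs x (~` U) by apply: open_nbhs_nbhs; split => //; exact: closed_openC.
by apply: filterS => y nUy /interior_subset.
Qed.

Variables (v : R * R) (a F d : R * R -> R) (eps : R).
Hypothesis e0 : 0 < eps.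
Hypothesis wa : forall x, U° x -> is_derive x v w (a x).
Hypothesis Fd : forall x, U° x -> is_derive x v F (d x).
Hypothesis ca : forall x, U° x -> {for x, continuous a}.
Hypothesis cF : forall x, U° x -> {for x, continuous F}.
Hypothesis cd : forall x, U° x -> {for x, continuous d}.

Definition cutflux (x : R * R) : R := ((fun x => cutoff eps (w x) * F x) \_ U°) x.

Definition dcutflux (x : R * R) : R :=
  ((fun x => dcutoff eps (w x) * (a x * F x) + cutoff eps (w x) * d x) \_ U°) x.

Lemma near_interior x : U° x -> \forall y \near x, U° y.
Proof. by move=> Ux; apply: open_nbhs_nbhs; split => //; exact: open_interior. Qed.

(** Around a boundary point [|w| < eps] by continuity, and around a point outside [U] the extension
    by zero applies. In both cases a whole neighbourhood sees only zeros, so a blow-up of [d] at the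
    boundary never enters. *)
Lemma cutflux_near0 x : ~ U° x ->
  (\near x, cutflux x = 0) /\ (\near x, dcutflux x = 0).
Proof.
move=> Ux; split; apply: filterS (vanishing_near e0 Ux) => y; rewrite /cutflux /dcutflux;
  rewrite patchE; case: ifPn => //; rewrite inE => Uy /(_ Uy) /(cutoff_small e0)[c1 c2];
  by rewrite ?c1 ?c2 ?mul0r ?addr0.
Qed.

Lemma is_derive_cutflux x : is_derive x v cutflux (dcutflux x).
Proof.
have [Ux|Ux] := pselect (U° x); last first.
  have [h0 k0] := cutflux_near0 Ux.
  rewrite (nbhs_singleton k0); apply: (near_eq_is_derive (f := cst 0)) => //.
  by apply: filterS h0 => y ->.
have dw := is_derive_comp (is_derive_cutoff (w x) e0) (wa Ux).
have dh := is_deriveM dw (Fd Ux).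
apply: (near_eq_is_derive (f := (cutoff eps \o w) * F)).
  apply: filterS (near_interior Ux) => y Uy.
  by rewrite /cutflux patchE mem_set.
apply: is_derive_eq; rewrite /dcutflux patchE mem_set//= /GRing.scale/=; ring.
Qed.

Lemma continuous_dcutflux : continuous dcutflux.
Proof.
move=> x; have [Ux|Ux] := pselect (U° x); last first.
  have [h0 k0] := cutflux_near0 Ux.
  rewrite /continuous_at (nbhs_singleton k0).
  exact: cvg_near_cst.
have [cc cdc] := continuous_cutoff e0.
have cwx := within_continuous_interior cw Ux.
rewrite /continuous_at {2}/dcutflux patchE mem_set//.
have C : dcutoff eps (w y) * (a y * F y) + cutoff eps (w y) * d y @[y --> x] -->
    dcutoff eps (w x) * (a x * F x) + cutoff eps (w x) * d x.
  apply: cvgD; apply: cvgM.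
  - by apply: (continuous_comp (f := w) (g := dcutoff eps)); [exact: cwx|exact: cdc].
  - by apply: cvgM; [exact: ca|exact: cF].
  - by apply: (continuous_comp (f := w) (g := cutoff eps)); [exact: cwx|exact: cc].
  - exact: cd.
apply: cvg_trans C; apply: near_eq_cvg; apply: filterS (near_interior Ux) => y Uy.
by rewrite /dcutflux patchE mem_set.
Qed.

Hypothesis U_bounded : bounded_set U.

Lemma cutflux_box : exists2 M : R, 0 < M &
  forall x, ~ (`|x.1| < M /\ `|x.2| < M) -> cutflux x = 0 /\ dcutflux x = 0.
Proof.
have [M M0 UM] := bounded_set_box U_bounded; exists M => // x xM.
rewrite /cutflux /dcutflux !patchE memNset// => /interior_subset /UM; exact: xM.
Qed.

Lemma integrable_dcutflux : leb2.-integrable [set: P] (EFin \o dcutflux).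
Proof.
have [M M0 UM] := cutflux_box.
apply: (@supported_integrable_plane _ _ M continuous_dcutflux) => x xM.
by apply: (UM x _).2 => /(@sub_box _ [set x | `|x.1| < M /\ `|x.2| < M]) H; exact/xM/H.
Qed.

Lemma integral_dcutflux : v = (1, 0) \/ v = (0, 1) ->
  (\int[leb2]_x (dcutflux x)%:E = 0)%E.
Proof.
have [M M0 UM] := cutflux_box.
case=> vE; move: is_derive_cutflux; rewrite vE => dh.
- by apply: (integral_derive_x0 M0 dh continuous_dcutflux) => x /UM[].
- by apply: (integral_derive_y0 M0 dh continuous_dcutflux) => x /UM[].
Qed.

End CutoffDivergence.

(** * Integration by parts *)

Section IntegrationByParts.
Context {R : realType}.
Local Notation P := (measurableTypeR R * measurableTypeR R)%type.
Local Notation leb2 := ((@lebesgue_measure R \x @lebesgue_measure R)%E).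
Variables (U : set (R * R)) (w e F1 F2 a1 a2 d1 d2 : R * R -> R).
Hypothesis U_compact : compact U.
Hypothesis U_null : leb2.-negligible (U `\` U° : set P).
Hypothesis w0 : forall x, (U `\` U°) x -> w x = 0.
Hypotheses (cw : {within U, continuous w}) (ce : {within U, continuous e}).
Hypotheses (ca1 : {within U, continuous a1}) (ca2 : {within U, continuous a2}).
Hypotheses (cF1 : {within U, continuous F1}) (cF2 : {within U, continuous F2}).
Hypothesis wa1 : forall x : R * R, U° x -> is_derive x (1, 0) w (a1 x).
Hypothesis wa2 : forall x : R * R, U° x -> is_derive x (0, 1) w (a2 x).
Hypothesis Fd1 : forall x : R * R, U° x -> is_derive x (1, 0) F1 (d1 x).
Hypothesis Fd2 : forall x : R * R, U° x -> is_derive x (0, 1) F2 (d2 x).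
Hypothesis cd1 : forall x : R * R, U° x -> {for x, continuous d1}.
Hypothesis cd2 : forall x : R * R, U° x -> {for x, continuous d2}.
Hypothesis ed : forall x : R * R, U° x -> e x = d1 x + d2 x.

Let S x := a1 x * F1 x + a2 x * F2 x.

Let U_closed : closed U.
Proof. by apply: compact_closed => //; exact: norm_hausdorff. Qed.

Let mU : measurable (U : set P).
Proof. exact: closed_measurable_plane. Qed.

Let mUi : measurable (U° : set P).
Proof. by apply: open_measurable_plane; exact: open_interior. Qed.

Let U_bounded : bounded_set U. Proof. exact: compact_bounded. Qed.

Let cS : {within U, continuous S}.
Proof.
move: ca1 ca2 cF1 cF2 => /subspace_continuousP h1 /subspace_continuousP h2
  /subspace_continuousP h3 /subspace_continuousP h4.
apply/subspace_continuousP => x Ux.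
by apply: cvgD; apply: cvgM; [exact: h1|exact: h3|exact: h2|exact: h4].
Qed.

Let mint (f : R * R -> R) : {within U, continuous f} -> measurable_fun (U° : set P) f.
Proof.
move=> cf; apply: (measurable_funS (E := U : set P)) => //; first exact: interior_subset.
exact: within_continuous_measurable_plane.
Qed.

(** The identities for the two coordinate directions are added, and [d1 + d2] becomes [e]. From here
    on every function involved is bounded on [U]. *)
Let cutint (eps : R) : 0 < eps ->
  (\int[leb2]_(x in U°) (dcutoff eps (w x) * S x + cutoff eps (w x) * e x)%:E = 0)%E.
Proof.
move=> e0.
have ci (f : R * R -> R) : {within U, continuous f} ->
    forall x : R * R, U° x -> {for x, continuous f}.
  by move=> cf x; exact: within_continuous_interior.
have h1 := integral_dcutflux U_closed cw w0 e0 wa1 Fd1 (ci _ ca1) (ci _ cF1) cd1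
   U_bounded (or_introl erefl).
have h2 := integral_dcutflux U_closed cw w0 e0 wa2 Fd2 (ci _ ca2) (ci _ cF2) cd2
   U_bounded (or_intror erefl).
have i1 := integrable_dcutflux U_closed cw w0 e0 (ci _ ca1) (ci _ cF1) cd1
   U_bounded.
have i2 := integrable_dcutflux U_closed cw w0 e0 (ci _ ca2) (ci _ cF2) cd2
   U_bounded.
transitivity (\int[leb2]_x ((EFin \o dcutflux U w a1 F1 d1 eps) x +
                            (EFin \o dcutflux U w a2 F2 d2 eps) x)%E)%E.
  rewrite integral_mkcond; apply: eq_integral => x _.
  rewrite /= /dcutflux !patchE; case: ifPn => [|_]; last by rewrite adde0.
  rewrite inE => Ux; rewrite -EFinD (ed Ux); congr EFin; rewrite /S; ring.
by rewrite integralD// [X in (X + _)%E]h1 h2 adde0.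
Qed.

(** The pointwise limit of the cut-off integrands. Where [w] vanishes, [dcutoff] is [0] for every
    [eps], so the [S] term is lost there in the limit; hence the indicator. *)
Let f (x : R * R) : R := (w x != 0)%:R * S x + w x * e x.

Let eps n : R := n.+1%:R^-1.

Let fn n (x : R * R) : R := dcutoff (eps n) (w x) * S x + cutoff (eps n) (w x) * e x.

Let eps_gt0 n : 0 < eps n. Proof. by rewrite invr_gt0. Qed.

Let fn_cvg x : fn n x @[n --> \oo] --> f x.
Proof.
rewrite /f /fn; have [wx0|wx0] := eqVneq (w x) 0.
  rewrite wx0 mul0r mul0r addr0; apply: cvg_near_cst; apply: nearW => n.
  have [|-> ->] := @cutoff_small _ (eps n) 0 (eps_gt0 n); first by rewrite normr0.
  by rewrite !mul0r addr0.
have [c1 c2] := cutoff_cvg (@cvg_harmonic R) wx0.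
rewrite mul1r -[X in _ --> X + _]mul1r.
by apply: cvgD; apply: cvgM => //; exact: cvg_cst.
Qed.

Let measurable_fn n : measurable_fun (U° : set P) (fn n).
Proof.
have [cc cdc] := continuous_cutoff (eps_gt0 n).
apply: measurable_funD; apply: measurable_funM; try exact: mint.
- by apply: measurableT_comp; [exact: continuous_measurable_fun|exact: mint].
- by apply: measurableT_comp; [exact: continuous_measurable_fun|exact: mint].
Qed.

Let integral_f : (\int[leb2]_(x in U°) (f x)%:E = 0)%E.
Proof.
have [C C0 SC] := compact_within_bounded U_compact cS.
have [D D0 eD] := compact_within_bounded U_compact ce.
have [W W0 wW] := compact_within_bounded U_compact cw.
have bUi : bounded_set U°.
  by have [M [Mr MU]] := U_bounded; exists M; split => // N /MU h x /interior_subset /h.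
have m1 n : measurable_fun (U° : set P) (EFin \o fn n).
  by apply/measurable_EFinP; exact: measurable_fn.
have m2 : measurable_fun (U° : set P) (EFin \o f).
  apply/measurable_EFinP; apply: (measurable_fun_cvg (h := fn)) => //.
have c1 : {ae leb2, forall x, (U° : set P) x ->
    (EFin \o fn n) x @[n --> \oo] --> (EFin \o f) x}.
  by apply: (aeW leb2) => x _; apply: cvg_EFin; [exact: nearW|exact: fn_cvg].
(* The dominating constant combines the bound 8 on [dcutoff] with [|cutoff eps w| <= |w| <= W]; a
   constant is integrable because [U] is bounded. *)
have ig : leb2.-integrable (U° : set P) (EFin \o cst (8 * C + W * D)).
  by apply: (@bounded_integrable_plane _ _ (cst (8 * C + W * D)) `|8 * C + W * D|).
have fg : {ae leb2, forall x n, (U° : set P) x ->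
    (`|(EFin \o fn n) x| <= (EFin \o cst (8 * C + W * D)%R) x)%E}.
  apply: (aeW leb2) => x n /interior_subset Ux; rewrite lee_fin /fn.
  apply: (le_trans (ler_normD _ _)).
  rewrite (normrM (dcutoff _ _)) (normrM (cutoff _ _)); apply: lerD; apply: ler_pM => //.
  + exact: (dcutoff_le _ (eps_gt0 n)).
  + exact: (SC _ Ux).
  + exact: le_trans (cutoff_le _ (eps_gt0 n)) (wW _ Ux).
  + exact: (eD _ Ux).
have [_ _] := dominated_convergence mUi m1 m2 c1 ig fg.
rewrite [X in X @ _](_ : _ = cst 0%E).
  by move=> /(cvg_unique _ (cvg_cst _)) => /(_ (@ereal_hausdorff R)) <-.
by apply/funext => n /=; exact: cutint.
Qed.

(** On a line in the first direction, zeros of [w] with [a1 != 0] are transversal, hence countable,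
    and so the planar set is null by sections; likewise for [a2] in the second direction. *)
Let zeros_null : leb2.-negligible [set x : P | U° x /\ w x = 0 /\ a1 x != 0] /\
   leb2.-negligible [set x : P | U° x /\ w x = 0 /\ a2 x != 0].
Proof.
have mz (a : R * R -> R) : {within U, continuous a} ->
    measurable [set x : P | U° x /\ w x = 0 /\ a x != 0].
  move=> ca; rewrite [X in measurable X](_ : _ =
    (U° `&` w @^-1` [set 0]) `\` (U° `&` a @^-1` [set 0])).
    by apply: measurableD; [exact: (mint cw)|exact: (mint ca)].
  apply/seteqP; split => x /=; first by move=> [? [? /eqP ?]]; split => // -[].
  by move=> [[? ?] ax]; split => //; split => //; apply/eqP => ?; apply: ax.
split.
- apply/negligibleP; [exact: mz|]; apply: ysection_countable_null => [|y]; first exact: mz.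
  apply: (@transversal_zeros_countable _ (fun r => w (r, y)) (fun r => a1 (r, y))).
  by move=> r /= [Ux [? ?]]; split => //; apply: (is_derive_x _ _ _ _).1 (wa1 Ux).
- apply/negligibleP; [exact: mz|]; apply: xsection_countable_null => [|x]; first exact: mz.
  apply: (@transversal_zeros_countable _ (fun r => w (x, r)) (fun r => a2 (x, r))).
  by move=> r /= [Ux [? ?]]; split => //; apply: (is_derive_y _ _ _ _).1 (wa2 Ux).
Qed.

Lemma plane_integration_by_parts :
  plane_integral U (fun x => w x * e x) =
  - plane_integral U (fun x => a1 x * F1 x + a2 x * F2 x).
Proof.
have int_all (h : R * R -> R) : {within U, continuous h} ->
    leb2.-integrable (U : set P) (EFin \o h).
  exact: within_continuous_integrable_plane.
have cwe : {within U, continuous (fun x => w x * e x)}.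
  move: cw ce => /subspace_continuousP h1 /subspace_continuousP h2.
  by apply/subspace_continuousP => x Ux; apply: cvgM; [exact: h1|exact: h2].
suff : plane_integral U (fun x => S x + w x * e x) = 0.
  rewrite /plane_integral RintegralD//=; [|exact: int_all..].
  by move=> /eqP; rewrite addrC addr_eq0 => /eqP.
rewrite /plane_integral /Rintegral.
suff -> : (\int[leb2]_(x in U) (S x + w x * e x)%:E = 0)%E by [].
(* The boundary is null, so the integral over [U] may be taken over the interior, where [integral_f]
   applies. *)
have UD : (U `\` (U `\` U°) : set P) = U°.
  by rewrite setDD setIC; apply/setIidPl; exact: interior_subset.
have mN : measurable (U `\` U° : set P) by exact: measurableD.
have iS : leb2.-integrable (U : set P) (EFin \o (fun x => S x + w x * e x)).
  exact: (integrableD mU (int_all _ cS) (int_all _ cwe)).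
rewrite (negligible_integral mN mU iS); last exact/negligibleP.
rewrite UD -[RHS]integral_f; apply: ae_eq_integral => //.
- by apply/measurable_EFinP; apply: measurable_funD; exact: mint.
- by apply/measurable_EFinP; apply: (measurable_fun_cvg (h := fn)).
have [z1 z2] := zeros_null.
(* The two integrands can differ only where [w = 0] and [S != 0], and [S != 0] forces [a1] or [a2]
   to be nonzero. *)
apply: negligibleS (negligibleU z1 z2) => x /=.
move=> /not_implyP[Ux]; rewrite /f.
have [wx|wx] := eqVneq (w x) 0; last by rewrite mul1r.
have [a1x|a1x] := eqVneq (a1 x) 0; last by left.
have [a2x|a2x] := eqVneq (a2 x) 0; last by right.
by rewrite /S a1x a2x wx !mul0r !addr0.
Qed.

End IntegrationByParts.

(** * Differentiation under the integral sign *)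

Lemma within_continuous_comp (T S V : topologicalType) (A : set T) (B : set S)
    (g : T -> S) (f : S -> V) : {within A, continuous g} -> (forall x, A x -> B (g x)) ->
  {within B, continuous f} -> {within A, continuous (f \o g)}.
Proof.
move=> /subspace_continuousP cg gAB /subspace_continuousP cf.
apply/subspace_continuousP => x Ax; apply: (cvg_comp g f _ (cf _ (gAB _ Ax))).
move=> C; rewrite /within/= => nC.
have : \forall y \near within A (nbhs x), B (g y) -> C (g y) by exact: cg nC.
by rewrite !near_withinE; apply: filterS => y + Ay; apply => //; exact: gAB.
Qed.

Section TimeDerivative.
Context {R : realType}.
Local Notation P := (measurableTypeR R * measurableTypeR R)%type.
Local Notation leb2 := ((@lebesgue_measure R \x @lebesgue_measure R)%E).
Local Notation time := [set` `[(0 : R), +oo[].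

Lemma spacetimeP (U : set (R * R)) (u : R * R) (t : R) :
  spacetime U (u, t) <-> U u /\ 0 <= t.
Proof. by rewrite /spacetime /= in_itv/= andbT. Qed.

Lemma within_spacetime_slice (U : set (R * R)) (e : (R * R) * R -> R) (t : R) :
  0 <= t -> {within spacetime U, continuous e} ->
  {within U, continuous (fun u => e (u, t))}.
Proof.
move=> t0; apply: within_continuous_comp => [|u Uu]; last exact/spacetimeP.
exact/continuous_subspaceT/continuous_pairl.
Qed.

Lemma within_spacetime_line (U : set (R * R)) (e : (R * R) * R -> R) (u : R * R) :
  U u -> {within spacetime U, continuous e} ->
  {within time, continuous (fun t => e (u, t))}.
Proof.
move=> Uu; apply: within_continuous_comp => [|t].
  exact/continuous_subspaceT/continuous_pairr.
by rewrite /= in_itv/= andbT => t0; exact/spacetimeP.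
Qed.

(** Continuity at each [(u, t)] gives a product neighbourhood, in which both [e (u', s)] and
    [e (u', t)] are within [eps / 2] of [e (u, t)]. Compactness of [U] then yields one time
    neighbourhood valid for all [u]. *)
Lemma spacetime_uniform (U : set (R * R)) (e : (R * R) * R -> R) (t eps : R) :
  compact U -> {within spacetime U, continuous e} -> 0 <= t -> 0 < eps ->
  \forall s \near t, 0 <= s -> forall u, U u -> `|e (u, s) - e (u, t)| < eps.
Proof.
move=> cU /subspace_continuousP ce t0 e0.
have /compact_near_coveringP/near_covering_withinP := cU.
move=> /(_ R (nbhs t) (fun s u => 0 <= s -> `|e (u, s) - e (u, t)| < eps) _).
have H : forall u, U u -> \forall u' \near u & s \near t,
    U u' -> 0 <= s -> `|e (u', s) - e (u', t)| < eps.
  move=> u Uu.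
  have /cvgrPdist_lt/(_ (eps / 2)) := ce (u, t) ((@spacetimeP U u t).2 (conj Uu t0)).
  rewrite divr_gt0// => /(_ isT); rewrite near_withinE.
  move=> [[A B] /= [nA nB] AB].
  exists (A, B) => // -[u' s] [/= Au' Bs] Uu' s0.
  have h1 := AB (u', s) (conj Au' Bs) ((@spacetimeP U u' s).2 (conj Uu' s0)).
  have h2 := AB (u', t) (conj Au' (nbhs_singleton nB)) ((@spacetimeP U u' t).2 (conj
    Uu' t0)).
  rewrite (_ : _ - _ = (e (u, t) - e (u', t)) - (e (u, t) - e (u', s))); last ring.
  by apply: le_lt_trans (ler_normB _ _) _; rewrite (splitr eps) ltrD.
by move=> /(_ H); apply: filterS => s Hs s0 u Uu; exact: Hs.
Qed.

Lemma plane_integral_bound (U : set (R * R)) (h : R * R -> R) (c : R) :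
  compact U -> {within U, continuous h} -> (forall u, U u -> `|h u| <= c) ->
  `|plane_integral U h| <= c * fine (leb2 U).
Proof.
move=> cU ch hc; have mU := compact_measurable_plane cU.
have ih := within_continuous_integrable_plane cU ch.
apply: le_trans (le_normr_Rintegral mU ih) _.
rewrite -(Rintegral_cst leb2 mU); apply: le_Rintegral => //.
- have := integrable_norm ih; exact.
- by apply: (@bounded_integrable_plane _ _ (cst c) `|c|) => //; exact: compact_bounded.
Qed.

Lemma within_continuousB (T : topologicalType) (A : set T) (f g : T -> R) :
  {within A, continuous f} -> {within A, continuous g} ->
  {within A, continuous (fun x => f x - g x)}.
Proof.
move=> /subspace_continuousP h1 /subspace_continuousP h2.
by apply/subspace_continuousP => x Ax; apply: cvgB; [exact: h1|exact: h2].
Qed.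

Lemma within_continuousM (T : topologicalType) (A : set T) (f g : T -> R) :
  {within A, continuous f} -> {within A, continuous g} ->
  {within A, continuous (fun x => f x * g x)}.
Proof.
move=> /subspace_continuousP h1 /subspace_continuousP h2.
by apply/subspace_continuousP => x Ax; apply: cvgM; [exact: h1|exact: h2].
Qed.

(** Uniform convergence on a set of finite measure. The filter is left general so that it covers
    both one-sided limits in time and limits of difference quotients at a punctured point. *)
Lemma plane_integral_lim (U : set (R * R)) (F : set_system R) (h : R -> R * R -> R)
    (l : R * R -> R) : Filter F -> compact U -> {within U, continuous l} ->
  (\forall s \near F, {within U, continuous (h s)}) ->
  (forall eps, 0 < eps -> \forall s \near F, forall u, U u -> `|h s u - l u| <= eps) ->
  plane_integral U (h s) @[s --> F] --> plane_integral U l.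
Proof.
move=> FF cU cl ch hl; apply/cvgrPdist_le => eps e0.
set m := fine (leb2 U).
have m0 : 0 <= m by rewrite fine_ge0.
have mU := compact_measurable_plane cU.
(* [m + 1] rather than [m], which could be zero. *)
have e1 : 0 < eps / (m + 1) by rewrite divr_gt0// ltr_wpDl.
apply: filterS2 (ch) (hl _ e1) => s chs hls.
rewrite distrC /plane_integral -RintegralB//;
  [|exact: within_continuous_integrable_plane..].
apply: le_trans (plane_integral_bound (h := fun u => h s u - l u) cU _ hls) _.
  exact: within_continuousB.
rewrite -/m mulrAC ler_pdivrMr ?ltr_wpDl//.
by rewrite ler_pM2l// lerDl.
Qed.

Lemma plane_integral_continuous (U : set (R * R)) (e : (R * R) * R -> R) :
  compact U -> {within spacetime U, continuous e} ->
  {within time, continuous (fun t => plane_integral U (fun u => e (u, t)))}.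
Proof.
move=> cU ce; apply/subspace_continuousP => t; rewrite /= in_itv/= andbT => t0.
apply: (plane_integral_lim (h := fun s u => e (u, s))) => //.
- exact: within_spacetime_slice.
- rewrite near_withinE; apply: nearW => s; rewrite /= in_itv/= andbT => s0.
  exact: within_spacetime_slice.
- move=> eps e0; rewrite near_withinE.
  apply: filterS (spacetime_uniform cU ce t0 e0) => s Hs.
  by rewrite /= in_itv/= andbT => s0 u Uu; rewrite ltW// Hs.
Qed.

(** Differentiability is assumed only for positive times, so that the base point [x = 0] is allowed;
    [y] may lie on either side of [x], which is why [c] is located by its distance to [x]. *)
Lemma half_line_mean_value (f df : R -> R) (x y : R) : 0 <= x -> 0 <= y ->
  {within time, continuous f} -> (forall t : R, 0 < t -> is_derive t 1 f (df t)) ->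
  exists c : R, [/\ 0 <= c, `|c - x| <= `|y - x| & f y - f x = df c * (y - x)].
Proof.
move=> x0 y0 cf hf.
have seg a b : 0 <= a -> a <= b -> exists2 c, c \in `[a, b]%R & f b - f a = df c * (b - a).
  move=> a0 ab; apply: MVT_segment => //.
    by move=> t; rewrite in_itv/= => /andP[at_ _]; apply: hf; exact: le_lt_trans at_.
  apply: continuous_subspaceW cf => t; rewrite /= !in_itv/= => /andP[at_ _].
  by rewrite andbT (le_trans a0).
have [xy|/ltW yx] := leP x y.
- have [c] := seg _ _ x0 xy; rewrite in_itv/= => /andP[c1 c2] E.
  exists c; split => //; first exact: le_trans c1.
  by rewrite !ger0_norm ?subr_ge0// lerB.
- have [c] := seg _ _ y0 yx; rewrite in_itv/= => /andP[c1 c2] E.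
  exists c; split; first exact: le_trans c1.
    by rewrite !ler0_norm ?subr_le0// !opprB lerB.
  by rewrite -opprB E -mulrN opprB.
Qed.

(** By the mean value theorem the difference quotient of [q] at [u] is [e (u, c)] with [c] between
    [t] and [s]. By [spacetime_uniform] this is close to [e (u, t)] uniformly in [u], even though
    [c] depends on [u]. *)
Lemma derivative_plane_integral (U : set (R * R)) (q e : (R * R) * R -> R) (t : R) :
  compact U -> {within spacetime U, continuous q} -> {within spacetime U, continuous e} ->
  (forall u (s : R), U u -> 0 < s -> is_derive s 1 (fun s => q (u, s)) (e (u, s))) ->
  0 <= t ->
  derivative_within time (fun s => plane_integral U (fun u => q (u, s))) t
    (plane_integral U (fun u => e (u, t))).
Proof.
move=> cU cq ce qe t0; rewrite /derivative_within.
have mU := compact_measurable_plane cU.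
have tD : \forall s \near within time t^', 0 <= s.
  by rewrite near_withinE; apply: nearW => s; rewrite /= in_itv/= andbT.
pose h s u := (q (u, s) - q (u, t)) / (s - t).
have ch s : 0 <= s -> {within U, continuous (h s)}.
  move=> s0; apply: within_continuousM; last exact/continuous_subspaceT/cst_continuous.
  by apply: within_continuousB; exact: within_spacetime_slice.
apply: (@cvg_trans _ (plane_integral U (h s) @[s --> within time t^'])).
  apply: near_eq_cvg; apply: filterS tD => s s0.
  rewrite /plane_integral /h RintegralZr//; last first.
    apply: within_continuous_integrable_plane => //.
    by apply: within_continuousB; exact: within_spacetime_slice.
  congr (_ / _); apply: RintegralB => //;
    by apply: within_continuous_integrable_plane => //; exact: within_spacetime_slice.
apply: plane_integral_lim => //.
- exact: within_spacetime_slice.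
- by apply: filterS tD => s; exact: ch.
move=> eps e0.
have /nbhs_ballP[d /= d0 dP] := spacetime_uniform cU ce t0 e0.
have H : \forall s \near within time t^', `|s - t| < d.
  rewrite near_withinE; apply: (@filterS _ _ _ (fun s => `|s - t| < d)) => //.
  by apply: nbhs_dnbhs; apply/nbhs_ballP; exists d => // s; rewrite -ball_normE/= distrC.
have H' : \forall s \near within time t^', s != t.
  by rewrite near_withinE; apply: filterS (nbhs_dnbhs_neq t) => s st _.
apply: filterS3 tD H H' => s s0 sd st u Uu.
have [c [c0 ct E]] := half_line_mean_value t0 s0 (within_spacetime_line Uu cq)
  (fun s => @qe u s Uu).
rewrite /h E mulfK ?subr_eq0// ltW//; apply: dP => //.
by rewrite -ball_normE/= distrC (le_lt_trans ct).
Qed.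

End TimeDerivative.

(** * The function Lambda *)

Section Lobachevsky.
Context {R : realType}.
Local Notation leb := (@lebesgue_measure R).

Lemma is_derive_one_sub_ln_primitive (t : R) : 0 < t ->
  is_derive t 1 (fun x : R => 2 * x - x * ln x) (1 - ln t).
Proof.
move=> t0; have dl := is_derive1_ln t0.
have dm := is_deriveM (is_derive_id t (1 : R)) dl.
have dz := is_deriveZ 2 (is_derive_id t (1 : R)).
have db := is_deriveB dz dm.
apply: is_derive_eq; rewrite /= /GRing.scale/=; field; exact: lt0r_neq0.
Qed.

(* [1 - ln] is the majorant of [|ln (2 sin t)|] near [0]. *)
Lemma integral_one_sub_ln_le (e : R) : 0 < e -> e <= 1 ->
  (\int[leb]_(t in `]0%R, e]) (1 - ln t)%:E <= (2 * e - e * ln e)%:E)%E.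
Proof.
move=> e0 e1.
(* The logarithm is singular at [0], so the half-open interval is exhausted by compact ones. On each
   of them the fundamental theorem applies, and the contribution of the lower endpoint, being at
   most [0], is dropped. *)
pose F n := `[n.+1%:R^-1 : R, e]%classic.
have -> : `]0, e]%classic = \bigcup_n F n.
  apply/seteqP; split => t; rewrite /= ?in_itv/=; last first.
    by move=> [n _]; rewrite /F/= !in_itv/= => /andP[n0 ->];
      rewrite (lt_le_trans _ n0)// invr_gt0.
  move=> /andP[t0 te]; have [n _ nP] := near_infty_natSinv_lt (PosNum t0).
  by exists n => //; rewrite /F/= in_itv/= te andbT ltW//; apply: (nP n) => /=.
have cl (a b : R) : 0 < a -> {within `[a, b], continuous (fun t : R => 1 - ln t)}.
  move=> a0; apply: continuous_in_subspaceT => t; rewrite inE/= in_itv/= => /andP[at_ _].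
  by apply: cvgB; [exact: cvg_cst|apply: continuous_ln; exact: lt_le_trans at_].
have mF n : measurable_fun (F n) (fun t => (1 - ln t)%:E).
  apply/measurable_EFinP.
  have n0 : 0 < n.+1%:R^-1 :> R by rewrite invr_gt0.
  exact: (subspace_continuous_measurable_fun (measurable_itv `[n.+1%:R^-1 :
    R, e]) (cl _ e n0)).
have lnle (t : R) : 0 < t -> t <= e -> ln t <= 0 by move=> t0 te;
  rewrite ln_le0// (le_trans te).
have K0 (t : R) : 0 < t -> t <= e -> 0 <= 2 * t - t * ln t.
  move=> t0 te; have := lnle _ t0 te; nra.
have nd : nondecreasing_seq F.
  move=> n m nm; apply/subsetPset => t; rewrite /F/= !in_itv/= => /andP[nt ->].
  by rewrite andbT; apply: le_trans nt; rewrite lef_pV2 ?posrE// ler_nat.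
have cv := @ge0_nondecreasing_set_cvg_integral _ (measurableTypeR R) R F (fun t => (1 -
  ln t)%:E) leb nd.
have {}cv := cv (fun n => measurable_itv _) mF.
have {}cv : (\int[leb]_(x in F i) (1 - ln x)%:E @[i --> \oo] -->
    \int[leb]_(x in \bigcup_i F i) (1 - ln x)%:E)%E.
  apply: cv => n t; rewrite /F/= in_itv/= => /andP[nt te]; rewrite lee_fin.
  have t0 : 0 < t by apply: lt_le_trans nt; rewrite invr_gt0.
  by have := lnle _ t0 te; lra.
rewrite -(cvg_lim (@ereal_hausdorff R) cv).
apply: lime_le; first exact: cvgP cv.
apply: nearW => n; have n0 : 0 < n.+1%:R^-1 :> R by rewrite invr_gt0.
(* For small [n] the interval [F n] is a point or empty, and its integral is [0]. *)
have [ne|en] := ltP n.+1%:R^-1 e; last first.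
  apply: (@le_trans _ _ 0%E); last by rewrite lee_fin; exact: K0.
  rewrite /F; move: en; rewrite le_eqVlt => /predU1P[<-|en].
    by rewrite set_itv1 integral_set1.
  by rewrite set_itv_ge ?integral_set0// bnd_simp -ltNge.
rewrite (@continuous_FTC2 _ _ (fun x : R => 2 * x - x * ln x)) //.
- by rewrite -EFinB lee_fin gerBl K0// ltW.
- exact: cl.
- have dK (t : R) : n.+1%:R^-1 <= t -> is_derive t 1 (fun x :
    R => 2 * x - x * ln x) (1 - ln t).
    by move=> nt; apply: is_derive_one_sub_ln_primitive; exact: lt_le_trans nt.
  have cK (t : R) : n.+1%:R^-1 <= t -> {for t, continuous (fun x : R => 2 * x - x * ln x)}.
    move=> nt; apply: differentiable_continuous; apply/derivable1_diffP.
    by have [] := dK t nt.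
  split.
  + by move=> t; rewrite in_itv/= => /andP[/ltW /dK[]].
  + by apply: cvg_at_right_filter; exact: cK.
  + by apply: cvg_at_left_filter; apply: cK; exact: ltW.
- move=> t; rewrite in_itv/= => /andP[nt _]; rewrite derive1E.
  by have [_ ->] := is_derive_one_sub_ln_primitive (lt_trans n0 nt).
Qed.

Lemma continuous_ln_sin (t : R) : 0 < t < pi ->
  {for t, continuous (fun t : R => ln (2 * sin t))}.
Proof.
move=> t0pi; have s0 : 0 < 2 * sin t by rewrite mulr_gt0// sin_gt0_pi// in_itv.
apply: (@continuous_comp _ _ _ (fun t : R => 2 * sin t) (@ln R)).
  by apply: cvgM; [exact: cvg_cst|exact: continuous_sin].
exact: continuous_ln.
Qed.

(** Choose [e <= 1] with [cos >= 1/2] on [[0, e]]. The mean value theorem gives [t <= 2 sin t]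
    there, so [ln t <= ln (2 sin t) <= ln 2 <= 1] and [|ln (2 sin t)| <= 1 - ln t]. On [[e, u]] the
    integrand is continuous. *)
Lemma integrable_ln_sin (u : R) : 0 < u -> u < pi ->
  leb.-integrable `[0, u] (EFin \o (fun t => ln (2 * sin t))).
Proof.
move=> u0 upi.
have [e [e0 e1 eu cose]] : exists e : R, [/\ 0 < e, e <= 1, e <= u &
    forall t : R, 0 <= t -> t <= e -> 1 / 2 <= cos t].
  have c0 : 1 / 2 < cos (0 : R) by rewrite cos0; lra.
  have : \forall t \near (0 : R), 1 / 2 < cos t.
    exact: cvgr_gt _ (@continuous_cos R 0) _ c0.
  move=> /nbhs_ballP[d /= d0 dP]; exists (Num.min u (Num.min 1 (d / 2))).
  split; rewrite ?lt_min ?ge_min ?lexx ?u0 ?ltr01 ?divr_gt0// ?orbT//.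
  move=> t t0; rewrite !le_min => /andP[_ /andP[_ td]]; apply/ltW/dP.
  by rewrite -ball_normE/= sub0r normrN ger0_norm//; lra.
have sin_ge (t : R) : 0 < t -> t <= e -> t <= 2 * sin t.
  move=> t0 te.
  have [|c] := @MVT R sin cos 0 t t0 (fun x _ => is_derive_sin x).
    exact/continuous_subspaceT/continuous_sin.
  rewrite in_itv/= sin0 !subr0 => /andP[c0 ct] ->.
  have := cose c (ltW c0) (ltW (lt_le_trans ct te)); nra.
have mf (a b : R) : 0 <= a -> b < pi -> measurable_fun `]a, b] (fun t :
  R => ln (2 * sin t)).
  move=> a0 bpi; apply: (measurable_funS (E := `]0, pi[%classic)) => //.
    by apply: subset_itv; rewrite bnd_simp.
  apply: open_continuous_measurable_fun => // t; rewrite inE/= in_itv/= => t0pi.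
  exact: continuous_ln_sin.
have mabs (a b : R) : 0 <= a -> b < pi ->
    measurable_fun `]a, b] (fun t : R => (`|ln (2 * sin t)|)%:E).
  by move=> a0 bpi; apply/measurable_EFinP; apply: measurableT_comp => //; exact: mf.
have m0u := mf 0 u (lexx _) upi.
apply/integrableP; split.
  by apply/measurable_EFinP/measurable_fun_itv_obnd_cbndP.
rewrite -integral_itv_obnd_cbnd; last exact: mabs.
rewrite (@itv_bndbnd_setU _ _ _ (BRight e)) ?bnd_simp// ?ltW//.
rewrite ge0_integral_setU//=; last 2 first.
- by rewrite -itv_bndbnd_setU ?bnd_simp ?(ltW e0)//; exact: mabs.
- apply/disj_setPS => t [/=]; rewrite !in_itv/= => /andP[_ te] /andP[et _].
  by move: te; rewrite leNgt et.
apply: lte_add_pinfty.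
  apply: le_lt_trans (_ : _ <= (2 * e - e * ln e)%:E)%E _; last exact: ltry.
  apply: le_trans (integral_one_sub_ln_le e0 e1); apply: ge0_le_integral => //.
  - by apply: mabs => //; exact: le_lt_trans upi.
  - by apply/measurable_EFinP; apply: measurable_funB => //; exact: measurable_funTS.
  - move=> t; rewrite /= in_itv/= => /andP[t0 te]; rewrite lee_fin ler_norml.
    have st := sin_ge t t0 te.
    have l1 : ln t <= ln (2 * sin t) by rewrite ler_ln ?posrE// (lt_le_trans t0).
    have l2 : ln (2 * sin t) <= 1.
      apply: (@le_trans _ _ (ln (1 + 1))); last by apply: le_ln1Dx; lra.
      by rewrite ler_ln ?posrE ?(lt_le_trans t0)//; have := sin_le1 t; lra.
    have l3 : ln t <= 0 by rewrite ln_le0// (le_trans te).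
    by apply/andP; split; lra.
have : leb.-integrable `[e, u] (EFin \o (fun t => ln (2 * sin t))).
  apply: continuous_compact_integrable; first exact: segment_compact.
  apply: continuous_in_subspaceT => t; rewrite inE/= in_itv/= => /andP[et tu].
  by apply: continuous_ln_sin; rewrite (lt_le_trans e0 et) (le_lt_trans tu).
move=> /integrableP[me]; apply: le_lt_trans; apply: ge0_subset_integral => //.
- by move/measurable_EFinP in me; apply/measurable_EFinP; exact: measurableT_comp.
- by apply: subset_itv; rewrite bnd_simp.
Qed.

Lemma derive_Lambda (t : R) : 0 < t -> t < pi ->
  is_derive t 1 (@Lambda R) (ln (2 * sin t)).
Proof.
(* The midpoint of [t] and [pi] serves as right end of an integration interval that has [t] in its
   interior and stays below [pi]. *)
move=> t0 tpi; have u1 : (t + pi) / 2 < pi :> R by lra.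
have tu : t < (t + pi) / 2 by lra.
have iu := integrable_ln_sin (lt_trans t0 tu) u1.
have ct : {for t, continuous (fun t : R => ln (2 * sin t))} by apply: continuous_ln_sin;
  rewrite t0.
have [dL L'] := continuous_FTC1_closed tu iu t0 ct.
by split; [exact: dL|rewrite -derive1E -L'].
Qed.

End Lobachevsky.

(** * The coefficients and the field W *)

Section Coefficients.
Context {R : realType}.
Implicit Types rho : (R * R)%type.

Lemma triangle_sin rho : triangle rho ->
  [/\ 0 < sin (pi * rho.1), 0 < sin (pi * rho.2),
      0 < sin (pi * (rho.1 + rho.2)) & 0 < sin (pi * (1 - rho.1 - rho.2))].
Proof.
move=> [r1 r2 r12]; have p0 := pi_gt0 R.
have H (x : R) : 0 < x -> x < 1 -> 0 < sin (pi * x).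
  move=> x0 x1; apply: sin_gt0_pi.
  by rewrite mulr_gt0//= gtr_pMr.
by split; apply: H; lra.
Qed.

Lemma triangle_sin_neq0 rho : triangle rho ->
  sin (pi * (rho.1 + rho.2)) != 0 /\ sin (pi * (rho.2 + rho.1)) != 0.
Proof.
by move=> /triangle_sin[_ _ s _]; rewrite (addrC rho.2) lt0r_neq0.
Qed.

Lemma is_derive_cot (x : R) : sin x != 0 -> is_derive x 1 cot (- (sin x ^+ 2)^-1).
Proof.
move=> s0; have dV := @is_deriveV _ sin x _ 1 s0 (is_derive_sin x).
have := is_deriveM (is_derive_cos x) dV; rewrite /cot => dM.
apply: is_derive_eq; rewrite /= /GRing.scale/=.
by rewrite -[in RHS](mul1r (_ ^-1)) -(cos2Dsin2 x); field.
Qed.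

Section Chain.
Context {V : normedModType R}.
Variables (z v : V).

Lemma is_derive_add (f g : V -> R) p q : is_derive z v f p -> is_derive z v g q ->
  is_derive z v (fun y => f y + g y) (p + q).
Proof. exact: is_deriveD. Qed.

Lemma is_derive_sub (f g : V -> R) p q : is_derive z v f p -> is_derive z v g q ->
  is_derive z v (fun y => f y - g y) (p - q).
Proof. exact: is_deriveB. Qed.

Lemma is_derive_scal (f : V -> R) a p : is_derive z v f p ->
  is_derive z v (fun y => a * f y) (a * p).
Proof. exact: is_deriveZ. Qed.

Lemma is_derive_mul (f g : V -> R) p q : is_derive z v f p -> is_derive z v g q ->
  is_derive z v (fun y => f y * g y) (f z * q + g z * p).
Proof. exact: is_deriveM. Qed.

Lemma is_derive_sin_comp (f : V -> R) p : is_derive z v f p ->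
  is_derive z v (fun y => sin (f y)) (cos (f z) * p).
Proof. by move=> df; exact: is_derive_comp (is_derive_sin _) df. Qed.

Lemma is_derive_cot_comp (f : V -> R) p : sin (f z) != 0 -> is_derive z v f p ->
  is_derive z v (fun y => cot (f y)) (- (sin (f z) ^+ 2)^-1 * p).
Proof. by move=> s0 df; exact: is_derive_comp (is_derive_cot s0) df. Qed.

End Chain.

(* The partial derivatives of [W1] in its first argument (here) and in its second
   ([dW_other]). *)
Definition dW_self (a b : R) : R := sin (pi * b) ^+ 2 / (2 * sin (pi * (a + b)) ^+ 2).

Definition dW_other (a b : R) : R :=
  dW_self a b - cot (pi * (a + b)) * sin (pi * b) * cos (pi * b)
  - 4^-1 + cos (2 * pi * b) / 2.

(** Stated for two arbitrary functions [p], [q] on a normed space because it is used both along a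
    segment of the triangle, for monotonicity, and on space-time, for the flux. *)
Lemma is_derive_W1 (V : normedModType R) (z v : V) (p q : V -> R) (p' q' : R) :
  sin (pi * (p z + q z)) != 0 ->
  is_derive z v p p' -> is_derive z v q q' ->
  is_derive z v (fun y => W1 (p y) (q y))
    (dW_self (p z) (q z) * p' + dW_other (p z) (q z) * q').
Proof.
move=> s0 dp dq; have p0 : pi != 0 :> R by rewrite gt_eqF ?pi_gt0.
have dpq := is_derive_scal pi (is_derive_add dp dq).
have dc := @is_derive_cot_comp _ z v (fun y => pi * (p y + q y)) _ s0 dpq.
have ds := is_derive_sin_comp (is_derive_scal pi dq).
have ds2 := is_derive_sin_comp (is_derive_scal (2 * pi) dq).
have d1 := is_derive_scal (- (2 * pi)^-1) (is_derive_mul dc (is_derive_mul ds ds)).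
have d4 := is_derive_add (is_derive_sub d1 (is_derive_scal 4^-1 dq))
  (is_derive_scal (4 * pi)^-1 ds2).
have -> : (fun y => W1 (p y) (q y)) = (fun y =>
   - (2 * pi)^-1 * (cot (pi * (p y + q y)) * (sin (pi * q y) * sin (pi * q y)))
   - 4^-1 * q y + (4 * pi)^-1 * sin (2 * pi * q y)).
  by apply/funext => y; rewrite /W1; ring.
apply: is_derive_eq; rewrite /dW_other /dW_self.
move: p0 s0 {dpq dc ds ds2 d1 d4}; move: (pi : R) => P P0 s0.
by field; rewrite s0 P0.
Qed.

(** The Hessian of [sigma] as a bilinear form in [v] and [v']; each cotangent is the derivative of
    [ln (2 sin)]. *)
Definition sigma2 (v v' rho : R * R) : R :=
  pi * (cot (pi * rho.1) * v.1 * v'.1 + cot (pi * rho.2) * v.2 * v'.2 +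
        cot (pi * (1 - rho.1 - rho.2)) * (v.1 + v.2) * (v'.1 + v'.2)).

Lemma is_derive_fst rho v : is_derive rho v fst v.1.
Proof.
apply/is_derive_dir0; have -> : (fun r : R => (rho + r *: v).1) =
  (fun r => rho.1 + r * v.1) by [].
by apply: is_derive_eq; rewrite /= /GRing.scale/=; ring.
Qed.

Lemma is_derive_snd rho v : is_derive rho v snd v.2.
Proof.
apply/is_derive_dir0; have -> : (fun r : R => (rho + r *: v).2) =
  (fun r => rho.2 + r * v.2) by [].
by apply: is_derive_eq; rewrite /= /GRing.scale/=; ring.
Qed.

Lemma is_derive_third rho v :
  is_derive rho v (fun r : R * R => 1 - r.1 - r.2) (- (v.1 + v.2)).
Proof.
have := is_derive_sub (is_derive_sub (is_derive_cst (1 :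
  R) rho v) (is_derive_fst rho v)) (is_derive_snd rho v).
by move=> h; apply: is_derive_eq; ring.
Qed.

Lemma is_derive_Lambda_comp (f : R * R -> R) rho v p : 0 < f rho -> f rho < 1 ->
  is_derive rho v f p ->
  is_derive rho v (fun r => Lambda (pi * f r)) (ln (2 * sin (pi * f rho)) * (pi * p)).
Proof.
move=> f0 f1 df; have p0 := pi_gt0 R.
apply: (@is_derive_comp _ _ (@Lambda R) (fun r => pi * f r)).
  by apply: derive_Lambda; rewrite ?mulr_gt0// gtr_pMr.
Qed.

Lemma is_derive_ln_sin_comp (f : R * R -> R) rho v p : 0 < f rho -> f rho < 1 ->
  is_derive rho v f p ->
  is_derive rho v (fun r => ln (2 * sin (pi * f r))) (cot (pi * f rho) * (pi * p)).
Proof.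
move=> f0 f1 df; have p0 := pi_gt0 R.
have s0 : 0 < sin (pi * f rho) by apply: sin_gt0_pi; rewrite mulr_gt0//= gtr_pMr.
have d2 := is_derive_scal 2 (is_derive_sin_comp (is_derive_scal pi df)).
have s20 : 0 < 2 * sin (pi * f rho) by rewrite mulr_gt0.
have := @is_derive_comp _ _ (@ln R) (fun r => 2 * sin (pi * f r)) rho v _ _
  (is_derive1_ln s20) d2.
move=> h; apply: is_derive_eq; rewrite /cot; field; exact: lt0r_neq0.
Qed.

Lemma triangle_open : open (@triangle R).
Proof.
have -> : @triangle R = [set r | 0 < r.1] `&` [set r | 0 < r.2] `&`
    [set r | 0 < 1 - r.1 - r.2].
  apply/seteqP; split => r /=; first by move=> [? ? ?]; split; [split|lra].
  by move=> [[? ?] ?]; split => //; lra.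
have o (f : R * R -> R) : continuous f -> open [set r | 0 < f r].
  by move=> cf; apply: (open_comp (f := f) (D := [set x | 0 < x])) => // r _; exact: cf.
apply: openI; first apply: openI; apply: o => r.
- exact: cvg_fst.
- exact: cvg_snd.
- by apply: cvgB; [apply: cvgB; [exact: cvg_cst|exact: cvg_fst]|exact: cvg_snd].
Qed.

Lemma derive_sigma rho v : triangle rho -> 'D_v sigma rho =
  ln (2 * sin (pi * rho.1)) * v.1 + ln (2 * sin (pi * rho.2)) * v.2
  - ln (2 * sin (pi * (1 - rho.1 - rho.2))) * (v.1 + v.2).
Proof.
move=> [r1 r2 r12].
have a1 : rho.1 < 1 by lra.
have a2 : rho.2 < 1 by lra.
have a3 : 0 < 1 - rho.1 - rho.2 by lra.
have a4 : 1 - rho.1 - rho.2 < 1 by lra.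
have h1 := @is_derive_Lambda_comp _ rho v _ r1 a1 (is_derive_fst rho v).
have h2 := @is_derive_Lambda_comp _ rho v _ r2 a2 (is_derive_snd rho v).
have h3 := @is_derive_Lambda_comp (fun r : R * R => 1 - r.1 - r.2) rho v _
  a3 a4 (is_derive_third rho v).
have h := is_derive_scal pi^-1 (is_derive_add (is_derive_add h1 h2) h3).
rewrite (@derive_val _ _ _ _ _ _ _ h).
have : pi != 0 :> R by rewrite gt_eqF ?pi_gt0.
by clear; move: (pi : R) => P P0; field.
Qed.

Lemma sigma_E rho i j : triangle rho ->
  sigma_ i j rho = sigma2 (basis2 i) (basis2 j) rho.
Proof.
move=> Tr; rewrite /sigma_; set v := basis2 j; set v' := basis2 i.
(* The formula for the first derivative has to hold in a neighbourhood before it can be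
   differentiated again. *)
have Tn : \forall r \near rho, triangle r by apply: open_nbhs_nbhs; split => //; exact:
  triangle_open.
rewrite (near_eq_derive (g := fun r : R * R =>
  v.1 * ln (2 * sin (pi * r.1)) + v.2 * ln (2 * sin (pi * r.2))
  - (v.1 + v.2) * ln (2 * sin (pi * (1 - r.1 - r.2))))); last first.
  by apply: filterS Tn => r Tr'; rewrite derive_sigma//; ring.
have [r1 r2 r12] := Tr.
have a1 : rho.1 < 1 by lra.
have a2 : rho.2 < 1 by lra.
have a3 : 0 < 1 - rho.1 - rho.2 by lra.
have a4 : 1 - rho.1 - rho.2 < 1 by lra.
have h1 := @is_derive_ln_sin_comp _ rho v' _ r1 a1 (is_derive_fst rho v').
have h2 := @is_derive_ln_sin_comp _ rho v' _ r2 a2 (is_derive_snd rho v').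
have h3 := @is_derive_ln_sin_comp (fun r : R * R => 1 - r.1 - r.2) rho v' _
  a3 a4 (is_derive_third rho v').
have h := is_derive_sub (is_derive_add (is_derive_scal v.1 h1) (is_derive_scal v.2 h2))
  (is_derive_scal (v.1 + v.2) h3).
rewrite (@derive_val _ _ _ _ _ _ _ h) /sigma2; ring.
Qed.

Lemma triangle_sin3 rho : sin (pi * (1 - rho.1 - rho.2)) = sin (pi * (rho.1 + rho.2)) /\
  cos (pi * (1 - rho.1 - rho.2)) = - cos (pi * (rho.1 + rho.2)).
Proof.
have -> : pi * (1 - rho.1 - rho.2) = - (pi * (rho.1 + rho.2)) + pi by ring.
by rewrite sinDpi cosDpi sinN cosN opprK.
Qed.

(** The angles [pi rho_1], [pi rho_2], [pi (1 - rho_1 - rho_2)] are those of a Euclidean triangle,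
    with sides proportional to their sines. The identities established first are its projection
    formulas and law of cosines. They eliminate [cos (pi rho_1)] and [cos (pi rho_2)]. The
    off-diagonal entries are compared only through their sum. *)
Lemma mu_sigma rho : triangle rho ->
  [/\ mu rho * sigma2 (1, 0) (1, 0) rho = dW_self rho.1 rho.2,
      mu rho * sigma2 (0, 1) (0, 1) rho = dW_self rho.2 rho.1,
      mu rho * sigma2 (1, 0) (0, 1) rho + mu rho * sigma2 (0, 1) (1, 0) rho =
      dW_other rho.1 rho.2 + dW_other rho.2 rho.1 &
      dW_other rho.1 rho.2 + dW_other rho.2 rho.1 =
      - sin (pi * rho.1) * sin (pi * rho.2) * cos (pi * (rho.1 + rho.2)) /
        sin (pi * (rho.1 + rho.2)) ^+ 2].
Proof.
move=> /triangle_sin[s1 s2 s12 _].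
have [e1 e2] := triangle_sin3 rho.
have p0 : pi != 0 :> R by rewrite gt_eqF ?pi_gt0.
have d2 (x : R) : cos (2 * pi * x) = 1 - 2 * sin (pi * x) ^+ 2.
  have -> : 2 * pi * x = pi * x + pi * x by ring.
  by rewrite cosD -!expr2; have := cos2Dsin2 (pi * x); lra.
have := cos2Dsin2 (pi * (rho.1 + rho.2)).
have : sin (pi * (rho.1 + rho.2)) * cos (pi * rho.1) =
       sin (pi * rho.2) + cos (pi * (rho.1 + rho.2)) * sin (pi * rho.1).
  rewrite mulrDr sinD cosD; have := cos2Dsin2 (pi * rho.1); nra.
have : sin (pi * (rho.1 + rho.2)) * cos (pi * rho.2) =
       sin (pi * rho.1) + cos (pi * (rho.1 + rho.2)) * sin (pi * rho.2).
  rewrite mulrDr sinD cosD; have := cos2Dsin2 (pi * rho.2); nra.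
have : sin (pi * rho.1) ^+ 2 + sin (pi * rho.2) ^+ 2 +
   2 * sin (pi * rho.1) * sin (pi * rho.2) * cos (pi * (rho.1 + rho.2)) =
   sin (pi * (rho.1 + rho.2)) ^+ 2.
  rewrite mulrDr sinD cosD; have := cos2Dsin2 (pi * rho.2); have := cos2Dsin2 (pi * rho.1).
  set S1 := sin _; set C1 := cos (pi * rho.1); set S2 := sin (pi * rho.2); set C2 := cos _.
  move=> h1 h2.
  have h3 : (C1 ^+ 2 + S1 ^+ 2) * S2 ^+ 2 = S2 ^+ 2 by rewrite h1 mul1r.
  have h4 : (C2 ^+ 2 + S2 ^+ 2) * S1 ^+ 2 = S1 ^+ 2 by rewrite h2 mul1r.
  by lra.
rewrite /mu /sigma2 /dW_other /dW_self /cot e1 e2 (addrC rho.2) !d2 /=.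
move: s1 s2 s12.
set S1 := sin _; set C1 := cos (pi * rho.1); set S2 := sin (pi * rho.2).
set C2 := cos (pi * rho.2); set S := sin _; set C := cos _.
move=> s1 s2 s12 k4 k2 k1 k3.
have C1E : C1 = (S2 + C * S1) / S by rewrite -k1; field; exact: lt0r_neq0.
have C2E : C2 = (S1 + C * S2) / S by rewrite -k2; field; exact: lt0r_neq0.
have S0 := lt0r_neq0 s12; have S10 := lt0r_neq0 s1; have S20 := lt0r_neq0 s2.
(* The Pythagorean relation in the multiplied form in which it occurs below, so that the last
   reduction is linear in the monomials. *)
have k3' : (S1 ^+ 2 + S2 ^+ 2) * (C ^+ 2 + S ^+ 2) = S1 ^+ 2 + S2 ^+ 2 by rewrite k3 mulr1.
have E : S2 ^+ 2 / (2 * S ^+ 2) - C / S * S2 * C2 - 4^-1 + (1 - 2 * S2 ^+ 2) / 2 +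
   (S1 ^+ 2 / (2 * S ^+ 2) - C / S * S1 * C1 - 4^-1 + (1 - 2 * S1 ^+ 2) / 2) =
   - S1 * S2 * C / S ^+ 2.
  have S20' : 2 * S ^+ 2 != 0 by rewrite mulf_neq0// expf_neq0.
  apply: (mulfI S20').
  transitivity (S1 ^+ 2 + S2 ^+ 2 - 2 * C * (2 * S1 * S2 + C * (S1 ^+ 2 + S2 ^+ 2))
    + S ^+ 2 - 2 * S ^+ 2 * (S1 ^+ 2 + S2 ^+ 2)); first by rewrite C1E C2E; field.
  transitivity (- 2 * S1 * S2 * C); first lra.
  by field.
rewrite E; clear E.
move: (pi : R) p0 {d2 e1 e2} => P P0.
split => //; rewrite ?C1E ?C2E; field; rewrite ?S0 ?S10 ?S20 ?P0//.
Qed.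

Lemma triangle_convex (p q : R * R) (s : R) : triangle p -> triangle q ->
  0 <= s <= 1 -> triangle (q + s *: (p - q)).
Proof.
move=> [p1 p2 p3] [q1 q2 q3] /andP[s0 s1].
have H (x y : R) : 0 < x -> 0 < y -> 0 < y + s * (x - y).
  by move=> x0 y0; have [xy|yx] := leP x y; nra.
split => /=; rewrite /GRing.scale/=; [exact: H|exact: H|].
have := H (1 - p.1 - p.2) (1 - q.1 - q.2); lra.
Qed.

(** The triangle is convex, so the mean value theorem applies to [s |-> d . W (q + s d)] on
    [[0, 1]]. Its derivative is the quadratic form of the Jacobian of [W] at [d], which sees only
    the symmetric part. *)
Lemma W_monotone (p q : R * R) : triangle p -> triangle q ->
  0 <= dotp (p - q) (W p - W q).
Proof.
move=> Tp Tq; set d := p - q.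
pose r (s : R) : R * R := q + s *: d.
have r0 : r 0 = q by rewrite /r scale0r addr0.
have r1 : r 1 = p by rewrite /r scale1r addrC subrK.
have dr1 (s : R) : is_derive s 1 (fun s : R => (r s).1) d.1.
  have -> : (fun s : R => (r s).1) = (fun s => q.1 + s * d.1) by [].
  by apply: is_derive_eq; rewrite /= /GRing.scale/=; ring.
have dr2 (s : R) : is_derive s 1 (fun s : R => (r s).2) d.2.
  have -> : (fun s : R => (r s).2) = (fun s => q.2 + s * d.2) by [].
  by apply: is_derive_eq; rewrite /= /GRing.scale/=; ring.
pose g (s : R) := d.1 * W1 (r s).1 (r s).2 + d.2 * W1 (r s).2 (r s).1.
pose dg (s : R) := d.1 * (dW_self (r s).1 (r s).2 * d.1 + dW_other (r s).1 (r s).2 * d.2) +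
  d.2 * (dW_self (r s).2 (r s).1 * d.2 + dW_other (r s).2 (r s).1 * d.1).
have Tr (s : R) : 0 <= s <= 1 -> triangle (r s) by exact: triangle_convex.
have hg (s : R) : 0 <= s <= 1 -> is_derive s 1 g (dg s).
  move=> /Tr/triangle_sin[_ _ s12 _].
  apply: is_derive_add; apply: is_derive_scal; apply: is_derive_W1 => //.
  - exact: lt0r_neq0.
  - by rewrite addrC lt0r_neq0.
have [||c] := @MVT R g dg 0 1 ltr01.
- by move=> s; rewrite in_itv/= => /andP[s0 s1]; apply: hg; rewrite !ltW.
- apply: derivable_within_continuous => s; rewrite in_itv/= => s01.
  by have [] := hg s s01.
rewrite in_itv/= => /andP[c0 c1]; rewrite subr0 mulr1 => E.
have -> : dotp d (W p - W q) = g 1 - g 0.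
  by rewrite /g r0 r1 /dotp /W /=; ring.
rewrite {}E.
have Tc : triangle (r c) by apply: Tr; rewrite !ltW.
have [_ _ _ E] := mu_sigma Tc.
have [s1 s2 s12 _] := triangle_sin Tc.
have -> : dg c = d.1 ^+ 2 * dW_self (r c).1 (r c).2 + d.2 ^+ 2 * dW_self (r c).2 (r c).1 +
  d.1 * d.2 * (dW_other (r c).1 (r c).2 + dW_other (r c).2 (r c).1) by rewrite /dg; ring.
rewrite E /dW_self (addrC (r c).2).
have k := cos2Dsin2 (pi * ((r c).1 + (r c).2)).
move: s1 s2 s12 k; set S1 := sin _; set S2 := sin (pi * (r c).2); set S := sin _;
  set C := cos _.
move=> s1 s2 s12 k.
have S0 := lt0r_neq0 s12.
(* Completing the square in [d.1]; the remainder is nonnegative since [C^2 + S^2 = 1]. *)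
rewrite (_ : _ + _ = ((S2 * d.1 - C * S1 * d.2) ^+ 2 + (S1 * d.2) ^+ 2 * (1 - C ^+ 2))
  / (2 * S ^+ 2)).
  have h : 0 <= 1 - C ^+ 2 by have := sqr_ge0 S; lra.
  by apply: divr_ge0; [apply: addr_ge0; [|apply: mulr_ge0 => //]|apply: mulr_ge0 => //];
    exact: sqr_ge0.
by field.
Qed.

End Coefficients.

(** * Symmetry of second derivatives *)

Section Schwarz.
Context {R : realType} {V : normedModType R}.
Implicit Types (f : V -> R) (z v w : V).

Lemma dist_lt_half (a b x e : R) :
  `|a - x| < e / 2 -> `|b - x| < e / 2 -> `|a - b| < e.
Proof.
by rewrite !ltr_norml => /andP[a1 a2] /andP[b1 b2]; apply/andP; split; lra.
Qed.

(** Two mean value theorems: in direction [v] for the increment of [f] across [h w], then in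
    direction [w] for ['D_v f]. *)
Lemma second_difference f z v w (h : R) : 0 < h ->
  (forall s r : R, 0 <= s <= h -> 0 <= r <= h ->
    derivable f (z + s *: v + r *: w) v /\
    derivable ('D_v f) (z + s *: v + r *: w) w) ->
  exists s r : R, [/\ 0 <= s <= h, 0 <= r <= h &
    f (z + h *: v + h *: w) - f (z + h *: v) - f (z + h *: w) + f z =
    'D_w ('D_v f) (z + s *: v + r *: w) * h * h].
Proof.
move=> h0 df; have h0' := ltW h0.
pose phi (s : R) := f (z + h *: w + s *: v) - f (z + s *: v).
pose dphi (s : R) := 'D_v f (z + h *: w + s *: v) - 'D_v f (z + s *: v).
have hphi (s : R) : 0 <= s <= h -> is_derive s 1 phi (dphi s).
  move=> sh; apply: is_derive_sub; apply/is_derive_line; apply: derivableP.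
    by rewrite addrAC; apply: (df s h sh _).1; rewrite h0' lexx.
  by have := (df s 0 sh _).1; rewrite scale0r addr0; apply; rewrite lexx.
have [||s] := @MVT R phi dphi 0 h h0.
- by move=> s; rewrite in_itv/= => /andP[s0 s1]; apply: hphi; rewrite !ltW.
- by apply: derivable_within_continuous => s; rewrite in_itv/= => /hphi[].
rewrite in_itv/= => /andP[/ltW s0 /ltW s1]; rewrite subr0 => E1.
have sh : 0 <= s <= h by rewrite s0.
pose chi (r : R) := 'D_v f (z + s *: v + r *: w).
pose dchi (r : R) := 'D_w ('D_v f) (z + s *: v + r *: w).
have hchi (r : R) : 0 <= r <= h -> is_derive r 1 chi (dchi r).
  move=> rh; have := derivableP (df s r sh rh).2.
  by move=> /(is_derive_line ('D_v f) (z + s *: v) w r _).2.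
have [||r] := @MVT R chi dchi 0 h h0.
- by move=> r; rewrite in_itv/= => /andP[r0 r1]; apply: hchi; rewrite !ltW.
- by apply: derivable_within_continuous => r; rewrite in_itv/= => /hchi[].
rewrite in_itv/= => /andP[/ltW r0 /ltW r1]; rewrite subr0 => E2.
exists s, r; split => //; first by rewrite r0.
rewrite -/(dchi r) -E2 /chi scale0r addr0 (addrAC z (s *: v)) -/(dphi s) -E1.
by rewrite /phi scale0r !addr0 (addrAC z (h *: w)); ring.
Qed.

(** The second difference of [f] is symmetric in [v] and [w], so it equals either mixed derivative,
    each at some point near [z], times [h^2]. Continuity at [z] closes the gap. *)
Lemma schwarz_symmetry f z v w :
  (\forall y \near z, [/\ derivable f y v, derivable f y w,
     derivable ('D_v f) y w & derivable ('D_w f) y v]) ->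
  {for z, continuous ('D_w ('D_v f))} -> {for z, continuous ('D_v ('D_w f))} ->
  'D_w ('D_v f) z = 'D_v ('D_w f) z.
Proof.
move=> df c1 c2; apply/eqP; rewrite -subr_eq0 -normr_le0; apply/ler_addgt0Pr => e e0.
rewrite add0r.
have e20 : 0 < e / 2 by rewrite divr_gt0.
have n1 := cvgr_dist_lt _ _ c1 _ e20; have n2 := cvgr_dist_lt _ _ c2 _ e20.
have cm : z + x.1 *: v + x.2 *: w @[x --> ((0 : R), (0 : R))] --> z.
  rewrite -[X in _ --> X]addr0 -(scale0r w) -[X in _ --> X + _]addr0 -(scale0r v).
  apply: cvgD; first apply: cvgD; first exact: cvg_cst.
    by apply: cvgZ; [exact: cvg_fst|exact: cvg_cst].
  by apply: cvgZ; [exact: cvg_snd|exact: cvg_cst].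
have : \forall x \near ((0 : R), (0 : R)), [/\
    [/\ derivable f (z + x.1 *: v + x.2 *: w) v, derivable f (z + x.1 *: v + x.2 *: w) w,
     derivable ('D_v f) (z + x.1 *: v + x.2 *: w) w & derivable ('D_w f) (z + x.1 *:
       v + x.2 *: w) v],
    `|'D_w ('D_v f) z - 'D_w ('D_v f) (z + x.1 *: v + x.2 *: w)| < e / 2 &
    `|'D_v ('D_w f) z - 'D_v ('D_w f) (z + x.1 *: v + x.2 *: w)| < e / 2].
  apply: (cm (fun y => [/\ [/\ derivable f y v, derivable f y w,
     derivable ('D_v f) y w & derivable ('D_w f) y v],
     `|'D_w ('D_v f) z - 'D_w ('D_v f) y| < e / 2 &
     `|'D_v ('D_w f) z - 'D_v ('D_w f) y| < e / 2])).
  have and3n (A B C : set V) : nbhs z A -> nbhs z B -> nbhs z C ->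
      nbhs z (fun y => [/\ A y, B y & C y]).
    by move=> nA nB nC; apply: filterS3 nA nB nC => y.
  exact: (and3n _ _ _ df (n1 (nbhs_filter z)) (n2 (nbhs_filter z))).
move=> /nbhs_ballP[d /= d0 dP].
(* Halving keeps the closed square [[0, h]^2] inside the open ball of radius [d]. *)
pose h := d / 2; have h0 : 0 < h by rewrite divr_gt0.
have H (s r : R) : 0 <= s <= h -> 0 <= r <= h -> ball ((0 : R), (0 : R)) d (s, r).
  move=> /andP[s0 s1] /andP[r0 r1]; split; rewrite /= -ball_normE/=
    sub0r normrN ger0_norm//;
    rewrite /h in s1 r1; lra.
have [|s [r [sh rh E1]]] := @second_difference f z v w h h0.
  by move=> s r sh rh; have [[/= b1 _ b2 _] _ _] := dP _ (H s r sh rh); exact: (conj b1 b2).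
have [|r' [s' [rh' sh' E2]]] := @second_difference f z w v h h0.
  move=> s' r' sh' rh'; have [[/= _ b1 _ b2] _ _] := dP _ (H r' s' rh' sh').
  by rewrite (addrAC z); exact: (conj b1 b2).
have [_ /= b1 _] := dP _ (H s r sh rh); have [_ _ /= b2] := dP _ (H s' r' sh' rh').
have E : 'D_w ('D_v f) (z + s *: v + r *: w) = 'D_v ('D_w f) (z + s' *: v + r' *: w).
  apply: (mulIf (lt0r_neq0 h0)); apply: (mulIf (lt0r_neq0 h0)).
  apply: etrans (esym E1) _.
  rewrite (addrAC z (h *: w)) (addrAC z (r' *: w)) in E2.
  by apply: etrans _ E2; congr (_ + _); exact: addrAC.
rewrite E in b1; apply/ltW; exact: dist_lt_half b1 b2.
Qed.

End Schwarz.

(** * Continuity of [W] and of its partial derivatives *)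

Section Continuity.
Context {R : realType}.

Lemma continuous_cot (x : R) : sin x != 0 -> {for x, continuous (@cot R)}.
Proof.
move=> s0; apply: cvgM; first exact: continuous_cos.
by apply: cvgV => //; exact: continuous_sin.
Qed.

Variables (T : Type) (F : set_system T) (p q : T -> R) (a b : R).
Context {FF : Filter F}.
Hypothesis pa : p x @[x --> F] --> a.
Hypothesis qb : q x @[x --> F] --> b.
Hypothesis s0 : sin (pi * (a + b)) != 0.

Lemma cvg_W1 : W1 (p x) (q x) @[x --> F] --> W1 a b.
Proof.
have c1 : pi * (p x + q x) @[x --> F] --> pi * (a + b).
  by apply: cvgM; [exact: cvg_cst|exact: cvgD].
have c2 : pi * q x @[x --> F] --> pi * b by apply: cvgM => //; exact: cvg_cst.
have c3 : 2 * pi * q x @[x --> F] --> 2 * pi * b by apply: cvgM => //; exact: cvg_cst.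
have k1 := cvg_comp _ _ c1 (continuous_cot s0).
have k2 := cvg_comp _ _ c2 (@continuous_sin R _).
have k3 := cvg_comp _ _ c3 (@continuous_sin R _).
have k4 := cvg_comp _ _ k2 (@exprn_continuous R 2 _).
apply: cvgD; first apply: cvgB.
- by apply: cvgN; apply: cvgM => //; apply: cvgM => //; exact: cvg_cst.
- by apply: cvgM => //; exact: cvg_cst.
- by apply: cvgM => //; exact: cvg_cst.
Qed.

Lemma cvg_dW_self : dW_self (p x) (q x) @[x --> F] --> dW_self a b.
Proof.
have c1 : pi * (p x + q x) @[x --> F] --> pi * (a + b).
  by apply: cvgM; [exact: cvg_cst|exact: cvgD].
have c2 : pi * q x @[x --> F] --> pi * b by apply: cvgM => //; exact: cvg_cst.
have k1 := cvg_comp _ _ (cvg_comp _ _ c1 (@continuous_sin R _)) (@exprn_continuous R 2 _).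
have k2 := cvg_comp _ _ (cvg_comp _ _ c2 (@continuous_sin R _)) (@exprn_continuous R 2 _).
apply: cvgM => //; apply: cvgV.
  by rewrite mulf_neq0// expf_neq0.
by apply: cvgM => //; exact: cvg_cst.
Qed.

Lemma cvg_dW_other : dW_other (p x) (q x) @[x --> F] --> dW_other a b.
Proof.
have c1 : pi * (p x + q x) @[x --> F] --> pi * (a + b).
  by apply: cvgM; [exact: cvg_cst|exact: cvgD].
have c2 : pi * q x @[x --> F] --> pi * b by apply: cvgM => //; exact: cvg_cst.
have c3 : 2 * pi * q x @[x --> F] --> 2 * pi * b by apply: cvgM => //; exact: cvg_cst.
have k1 := cvg_comp _ _ c1 (continuous_cot s0).
have k2 := cvg_comp _ _ c2 (@continuous_sin R _).
have k3 := cvg_comp _ _ c2 (@continuous_cos R _).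
have k4 := cvg_comp _ _ c3 (@continuous_cos R _).
apply: cvgD; first apply: cvgB; first apply: cvgB.
- exact: cvg_dW_self.
- by apply: cvgM => //; exact: cvgM.
- exact: cvg_cst.
- by apply: cvgM => //; exact: cvg_cst.
Qed.

End Continuity.

Lemma within_continuous_eq (T S : topologicalType) (A : set T) (f g : T -> S) :
  (forall x, A x -> f x = g x) -> {within A, continuous f} -> {within A, continuous g}.
Proof.
move=> fg /subspace_continuousP cf; apply/subspace_continuousP => x Ax.
change (g y @[y --> within A (nbhs x)] --> g x).
rewrite -(fg x Ax); apply: cvg_trans (cf x Ax); apply: near_eq_cvg.
by rewrite near_withinE; apply: nearW => y /fg.
Qed.

(** * The interior of space-time and derivatives extended to its closure *)

Section Spacetime.
Context {R : realType}.
Variable U : set (R * R).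
Hypothesis U_domain : closed_domain U.
Local Notation Q := (spacetime U).

Lemma interior_spacetime (u : R * R) (t : R) : U° u -> 0 < t -> Q° (u, t).
Proof.
move=> Uu t0; exists (U, [set s | 0 < s]) => /=.
  by split => //; exact: lt_nbhsr.
by move=> [u' s] [/= Uu' s0]; apply/spacetimeP; split => //; exact: ltW.
Qed.

(** Every point of [Q] is a limit of interior points: [U] is the closure of an open set, and the
    time is moved forward to leave [t = 0]. Hence the limit defining [derive_on] is taken along a
    proper filter and is unique. *)
Lemma spacetime_closure_interior z : Q z -> ProperFilter (within Q° (nbhs z)).
Proof.
case: z => u t /spacetimeP[Uu t0]; apply: within_nbhs_proper.
move=> B [[A I] /= [nA nI] AIB].
have [G [oO _ _ UE]] := U_domain.
have OU : G `<=` U° by rewrite -open_subsetE// UE; exact: subset_closure.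
have : closure G u by rewrite -UE.
move=> /(_ _ nA)[u' [Ou' Au']].
have /nbhs_ballP[d /= d0 dI] := nI.
exists (u', t + d / 2); split.
  apply: interior_spacetime; first exact: OU.
  by rewrite ltr_wpDl// divr_gt0.
apply: AIB; split => //=; apply: dI; rewrite -ball_normE/= opprD addNKr normrN.
by rewrite ger0_norm ?divr_ge0 ?ltW//; lra.
Qed.

(** On [Q] the limit [derive_on] agrees with the continuous extension provided by [C1_on], and
    therefore inherits its continuity. *)
Lemma derive_on_ext (v : (R * R) * R) (f : (R * R) * R -> R) : C1_on Q f ->
  {within Q, continuous (derive_on Q v f)} /\
  forall z, Q° z -> derive_on Q v f z = 'D_v f z.
Proof.
move=> [_ /(_ v)[df [g cg gD]]].
have E z : Q z -> derive_on Q v f z = g z.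
  move=> Qz; have PF := spacetime_closure_interior Qz.
  apply/cvg_lim; first exact: norm_hausdorff.
  have /subspace_continuousP/(_ _ Qz) cgz := cg.
  apply: (@cvg_trans _ (g y @[y --> within Q° (nbhs z)])).
    apply: near_eq_cvg; rewrite near_withinE; apply: nearW => y /gD; exact.
  apply: cvg_trans cgz ; apply: (cvg_app g) => C.
  change (within Q (nbhs z) C -> within Q° (nbhs z) C).
  by rewrite /within/= => H; apply: filterS H => y h /interior_subset /h.
split; last by move=> z Qz; rewrite E ?gD//; exact: interior_subset.
apply: (@within_continuous_eq _ _ Q g (derive_on Q v f)); last exact: cg.
by move=> z Qz; rewrite E.
Qed.

End Spacetime.

(** * The flux of a solution *)

Lemma sum_ord2 (R : realType) (F : 'I_2 -> 'I_2 -> R) :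
  \sum_(i < 2) \sum_(j < 2) F i j =
  F ord0 ord0 + F ord0 ord_max + (F ord_max ord0 + F ord_max ord_max).
Proof.
have e1 : lift ord0 ord0 = ord_max :> 'I_2 by apply/val_inj.
by rewrite !big_ord_recl !big_ord0 !e1 !addr0.
Qed.

(** The off-diagonal coefficients are known only through their sum (third hypothesis), so both mixed
    derivatives must be the same [w]: this is where the symmetry of second derivatives enters. *)
Lemma flux_algebra (R : realType) (m a b c d A B C E x y w : R) :
  m * a = A -> m * d = B -> m * b + m * c = C + E ->
  m * (a * x + b * w + (c * w + d * y)) = A * x + C * w + (B * y + E * w).
Proof.
move=> m1 m2 m3.
transitivity (m * a * x + m * d * y + (m * b + m * c) * w); first by ring.
by rewrite m1 m2 m3; ring.
Qed.

Section Solution.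
Context {R : realType}.
Variables (U : set (R * R)) (psi : (R * R) * R -> R).
Hypothesis U_domain : closed_domain U.
Hypothesis psi_solution : solution U psi.
Local Notation Q := (spacetime U).
Local Notation p1 := (fun z => (nabla U psi z).1).
Local Notation p2 := (fun z => (nabla U psi z).2).
Local Notation D i := (fun w => 'D_(dir_x i) psi w).

Lemma is_derive_slice (f : (R * R) * R -> R) (u v : R * R) (t l : R) :
  is_derive (u, t) (v, 0) f l -> is_derive u v (fun u => f (u, t)) l.
Proof.
move=> /is_derive_dir0 h; apply/is_derive_dir0.
rewrite [X in is_derive _ _ X _](_ : _ = (fun r : R => f ((u, t) + r *: (v, 0))))//.
by apply/funext => r; congr (f (_, _)); rewrite /= scaler0 addr0.
Qed.

Lemma is_derive_time_slice (f : (R * R) * R -> R) (u : R * R) (t l : R) :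
  is_derive (u, t) dir_t f l -> is_derive t 1 (fun s => f (u, s)) l.
Proof.
have E (r : R) : (u, r) = ((u, 0) : (R * R) * R) + r *: dir_t.
  by congr pair; rewrite /= ?scaler0 ?addr0// add0r scaler1.
rewrite E => /(is_derive_line f _ dir_t t l).2.
by under [X in is_derive _ _ X _ -> _]eq_fun do rewrite -E.
Qed.

Lemma gradient_continuous :
  {within Q, continuous p1} /\ {within Q, continuous p2}.
Proof.
have C1 := solution_C1 psi_solution.
by split; [exact: (derive_on_ext U_domain _ C1).1|exact: (derive_on_ext U_domain _ C1).1].
Qed.

Lemma gradient_interior z : Q° z -> p1 z = D ord0 z /\ p2 z = D ord_max z.
Proof.
move=> Qz; have C1 := solution_C1 psi_solution.
by split; [exact: (derive_on_ext U_domain _ C1).2|exact: (derive_on_ext U_domain _ C1).2].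
Qed.

Lemma is_derive_psi (v : (R * R) * R) z : Q° z -> is_derive z v psi ('D_v psi z).
Proof.
move=> Qz; apply: derivableP; have [_ /(_ v)[+ _]] := solution_C1 psi_solution.
by apply.
Qed.

Lemma is_derive_gradient i j z : Q° z ->
  is_derive z (dir_x i) (D j) (second_x psi i j z).
Proof.
move=> Qz; apply: derivableP.
by have [] := solution_C2 psi_solution i j Qz.
Qed.

Lemma gradient_near z : Q° z ->
  \forall y \near z, p1 y = D ord0 y /\ p2 y = D ord_max y.
Proof.
move=> Qz; have : nbhs z Q° by apply: open_nbhs_nbhs; split => //; exact: open_interior.
by apply: filterS => y; exact: gradient_interior.
Qed.

Lemma is_derive_gradient1 i z : Q° z ->
  is_derive z (dir_x i) p1 (second_x psi i ord0 z).
Proof.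
move=> Qz; apply: near_eq_is_derive (is_derive_gradient i ord0 Qz).
by apply: filterS (gradient_near Qz) => y [-> _].
Qed.

Lemma is_derive_gradient2 i z : Q° z ->
  is_derive z (dir_x i) p2 (second_x psi i ord_max z).
Proof.
move=> Qz; apply: near_eq_is_derive (is_derive_gradient i ord_max Qz).
by apply: filterS (gradient_near Qz) => y [_ ->].
Qed.

Definition flux1' z := dW_self (p1 z) (p2 z) * second_x psi ord0 ord0 z +
  dW_other (p1 z) (p2 z) * second_x psi ord0 ord_max z.

Definition flux2' z := dW_self (p2 z) (p1 z) * second_x psi ord_max ord_max z +
  dW_other (p2 z) (p1 z) * second_x psi ord_max ord0 z.

Lemma gradient_sin z : Q z ->
  sin (pi * (p1 z + p2 z)) != 0 /\ sin (pi * (p2 z + p1 z)) != 0.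
Proof.
by move=> /(solution_slope psi_solution)/triangle_sin_neq0.
Qed.

Lemma is_derive_flux z : Q° z ->
  is_derive z (dir_x ord0) (fun z => (W (nabla U psi z)).1) (flux1' z) /\
  is_derive z (dir_x ord_max) (fun z => (W (nabla U psi z)).2) (flux2' z).
Proof.
move=> Qz; have [s1 s2] := gradient_sin (interior_subset Qz).
split.
- exact: (@is_derive_W1 _ _ z _ p1 p2 _ _ s1 (is_derive_gradient1 ord0 Qz)
    (is_derive_gradient2 ord0 Qz)).
- exact: (@is_derive_W1 _ _ z _ p2 p1 _ _ s2 (is_derive_gradient2 ord_max Qz)
    (is_derive_gradient1 ord_max Qz)).
Qed.

Lemma flux_continuous :
  {within Q, continuous (fun z => (W (nabla U psi z)).1)} /\
  {within Q, continuous (fun z => (W (nabla U psi z)).2)}.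
Proof.
have [/subspace_continuousP c1 /subspace_continuousP c2] := gradient_continuous.
split; apply/subspace_continuousP => z Qz; have [s1 s2] := gradient_sin Qz.
- exact: (cvg_W1 (c1 z Qz) (c2 z Qz) s1).
- exact: (cvg_W1 (c2 z Qz) (c1 z Qz) s2).
Qed.

Lemma flux'_continuous z : Q° z ->
  {for z, continuous flux1'} /\ {for z, continuous flux2'}.
Proof.
move=> Qz; have [c1 c2] := gradient_continuous.
have {}c1 := within_continuous_interior c1 Qz.
have {}c2 := within_continuous_interior c2 Qz.
have c3 i j := (solution_C2 psi_solution i j Qz).2.
have [s1 s2] := gradient_sin (interior_subset Qz).
split; apply: cvgD; apply: cvgM; try exact: c3.
- exact: (cvg_dW_self c1 c2 s1).
- exact: (cvg_dW_other c1 c2 s1).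
- exact: (cvg_dW_self c2 c1 s2).
- exact: (cvg_dW_other c2 c1 s2).
Qed.

Lemma second_x_symmetric z : Q° z ->
  second_x psi ord0 ord_max z = second_x psi ord_max ord0 z.
Proof.
move=> Qz; apply: schwarz_symmetry.
- have : nbhs z Q° by apply: open_nbhs_nbhs; split => //; exact: open_interior.
  apply: filterS => y Qy.
  have d i j := (solution_C2 psi_solution i j Qy).1.
  have dp v : derivable psi y v by have [] := is_derive_psi v Qy.
  by split; [exact: dp|exact: dp|exact: d|exact: d].
- exact: (solution_C2 psi_solution ord0 ord_max Qz).2.
- exact: (solution_C2 psi_solution ord_max ord0 Qz).2.
Qed.

Lemma time_derivative_flux z : Q° z -> 'D_dir_t psi z = flux1' z + flux2' z.
Proof.
move=> Qz; rewrite (solution_eq psi_solution Qz).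
have Tz := solution_slope psi_solution (interior_subset Qz).
have [m1 m2 m3 _] := mu_sigma Tz.
rewrite (sum_ord2 (fun i j => sigma_ i j (nabla U psi z) * second_x psi i j z)).
rewrite (sigma_E ord0 ord0 Tz) (sigma_E ord0 ord_max Tz) (sigma_E ord_max ord0 Tz)
  (sigma_E ord_max ord_max Tz).
have -> : basis2 ord0 = ((1 : R), (0 : R)) by [].
have -> : basis2 ord_max = ((0 : R), (1 : R)) by [].
rewrite /flux1' /flux2' (second_x_symmetric Qz).
exact: (flux_algebra _ _ _ m1 m2 m3).
Qed.

End Solution.

(** * Contraction *)

Lemma derivative_within_is_derive {R : realType} (A : set R) (f : R -> R) (x l : R) :
  nbhs x A -> derivative_within A f x l -> is_derive x 1 f l.
Proof.
move=> nA fl.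
have {}fl : (f y - f x) / (y - x) @[y --> x^'] --> l.
  have dA : \forall y \near x^', A y by exact: nbhs_dnbhs.
  have sub (P : set R) : within A x^' P -> x^' P.
    by rewrite /within/= => H; apply: filterS2 dA H => y Ay; apply.
  by move=> C nC; apply: sub; exact: fl nC.
apply/is_derive1_caratheodory.
(* The Caratheodory slope: the difference quotient, completed by [l] at [x]. *)
exists (fun z => if z == x then l else (f z - f x) / (z - x)); split; last by rewrite eqxx.
- move=> z; have [->|zx] := eqVneq z x; first by rewrite !subrr mulr0.
  by rewrite divfK// subr_eq0.
- apply/continuous_withinNx; rewrite eqxx.
  apply: cvg_trans fl; apply: near_eq_cvg.
  by apply: filterS (nbhs_dnbhs_neq x) => z /negPf ->.
Qed.

Section Contraction.
Context {R : realType}.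
Variables (U : set (R * R)) (psi1 psi2 : (R * R) * R -> R).
Hypothesis U_compact : compact U.
Hypothesis U_domain : closed_domain U.
Hypothesis U_smooth : smooth_boundary U.
Hypotheses (psi1_solution : solution U psi1) (psi2_solution : solution U psi2).
Hypothesis psi_boundary : forall (u : R * R) (t : R),
  (U `\` U°) u -> 0 <= t -> psi1 (u, t) = psi2 (u, t).
Local Notation Q := (spacetime U).

Definition gap (z : (R * R) * R) : R := psi1 z - psi2 z.

Definition gap_t (z : (R * R) * R) : R :=
  derive_on Q dir_t psi1 z - derive_on Q dir_t psi2 z.

Definition gap_pairing (z : (R * R) * R) : R :=
  dotp (nabla U psi1 z - nabla U psi2 z) (W (nabla U psi1 z) - W (nabla U psi2 z)).

Lemma gap_continuous : {within Q, continuous gap}.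
Proof.
by apply: within_continuousB; [exact: (solution_C1 psi1_solution).1|exact:
  (solution_C1 psi2_solution).1].
Qed.

Lemma gap_t_continuous : {within Q, continuous gap_t}.
Proof.
apply: within_continuousB.
- exact: (derive_on_ext U_domain _ (solution_C1 psi1_solution)).1.
- exact: (derive_on_ext U_domain _ (solution_C1 psi2_solution)).1.
Qed.

Lemma gap_pairing_continuous : {within Q, continuous gap_pairing}.
Proof.
have [a1 a2] := gradient_continuous U_domain psi1_solution.
have [b1 b2] := gradient_continuous U_domain psi2_solution.
have [f1 f2] := flux_continuous U_domain psi1_solution.
have [g1 g2] := flux_continuous U_domain psi2_solution.
have h1 := within_continuousM (within_continuousB a1 b1) (within_continuousB f1 g1).
have h2 := within_continuousM (within_continuousB a2 b2) (within_continuousB f2 g2).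
move/subspace_continuousP in h1; move/subspace_continuousP in h2.
apply/subspace_continuousP => z Qz.
exact: (cvgD (h1 z Qz) (h2 z Qz)).
Qed.

Lemma gap_boundary u (t : R) : U u -> ~ U° u -> 0 <= t -> gap (u, t) = 0.
Proof. by move=> Uu nUu t0; rewrite /gap psi_boundary ?subrr. Qed.

Lemma is_derive_gap_t u (t : R) : U° u -> 0 < t ->
  is_derive t 1 (fun s => gap (u, s)) (gap_t (u, t)).
Proof.
move=> Uu t0; have Qz := interior_spacetime Uu t0.
have E psi : solution U psi -> is_derive t 1 (fun s => psi (u, s)) (derive_on Q dir_t
  psi (u, t)).
  move=> sol; apply: is_derive_time_slice.
  rewrite (derive_on_ext U_domain dir_t (solution_C1 sol)).2//.
  exact: (is_derive_psi sol).
exact: (is_derive_sub (E _ psi1_solution) (E _ psi2_solution)).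
Qed.

(** Differentiation under the integral needs this for every [u] in [U]. In the interior it is the
    product rule; on the boundary the gap is zero at all times [t >= 0], so both sides vanish. *)
Lemma is_derive_sqr_gap u (t : R) : U u -> 0 < t ->
  is_derive t 1 (fun s => gap (u, s) ^+ 2) (2 * (gap (u, t) * gap_t (u, t))).
Proof.
move=> Uu t0; have [Ui|nUi] := pselect (U° u).
  have h := is_derive_gap_t Ui t0.
  have := is_derive_mul h h => hh.
  have -> : (fun s => gap (u, s) ^+ 2) = (fun s => gap (u, s) * gap (u, s)).
    by apply/funext => s; rewrite expr2.
  by apply: is_derive_eq; ring.
rewrite (gap_boundary Uu nUi (ltW t0)) mul0r mulr0.
apply: (near_eq_is_derive (f := cst 0)) => //.
near=> s; rewrite gap_boundary ?expr0n//; apply: ltW; near: s; exact: lt_nbhsr.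
Unshelve. all: by end_near. Qed.

Lemma gap_integration_by_parts (t : R) : 0 < t ->
  plane_integral U (fun u => gap (u, t) * gap_t (u, t)) =
  - plane_integral U (fun u => gap_pairing (u, t)).
Proof.
move=> t0; have t0' := ltW t0.
have Qi u : U° u -> Q° (u, t) by move=> Uu; exact: interior_spacetime.
have [a1 a2] := gradient_continuous U_domain psi1_solution.
have [b1 b2] := gradient_continuous U_domain psi2_solution.
have [f1 f2] := flux_continuous U_domain psi1_solution.
have [g1 g2] := flux_continuous U_domain psi2_solution.
have S (f : (R * R) * R -> R) : {within Q, continuous f} ->
  {within U, continuous (fun u => f (u, t))}.
  exact: within_spacetime_slice.
pose d1 u := flux1' U psi1 (u, t) - flux1' U psi2 (u, t).
pose d2 u := flux2' U psi1 (u, t) - flux2' U psi2 (u, t).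
have grad psi : solution U psi -> forall u : R * R, U° u ->
    is_derive u (1, 0) (fun u => psi (u, t)) (nabla U psi (u, t)).1 /\
    is_derive u (0, 1) (fun u => psi (u, t)) (nabla U psi (u, t)).2.
  move=> sol u /Qi Qz; have [e1 e2] := gradient_interior U_domain sol Qz.
  rewrite e1 e2; split; apply: is_derive_slice.
  - exact: (is_derive_psi sol (dir_x ord0) Qz).
  - exact: (is_derive_psi sol (dir_x ord_max) Qz).
have flux psi : solution U psi -> forall u : R * R, U° u ->
    is_derive u (1, 0) (fun u => (W (nabla U psi (u, t))).1) (flux1' U psi (u, t)) /\
    is_derive u (0, 1) (fun u => (W (nabla U psi (u, t))).2) (flux2' U psi (u, t)).
  move=> sol u /Qi Qz; have [e1 e2] := is_derive_flux U_domain sol Qz.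
  by split; [exact: (is_derive_slice e1)|exact: (is_derive_slice e2)].
have cflux psi : solution U psi -> forall u : R * R, U° u ->
    {for u, continuous (fun u => flux1' U psi (u, t))} /\
    {for u, continuous (fun u => flux2' U psi (u, t))}.
  move=> sol u /Qi Qz; have [c1 c2] := flux'_continuous U_domain sol Qz.
  split.
  - exact: (@continuous_comp _ _ _ (fun u : R * R => (u, t)) (flux1' U psi) u
      (@continuous_pairl _ _ t u) c1).
  - exact: (@continuous_comp _ _ _ (fun u : R * R => (u, t)) (flux2' U psi) u
      (@continuous_pairl _ _ t u) c2).
apply: (@plane_integration_by_parts R U (fun u => gap (u, t)) (fun u => gap_t (u, t))
  (fun u => (W (nabla U psi1 (u, t))).1 - (W (nabla U psi2 (u, t))).1)
  (fun u => (W (nabla U psi1 (u, t))).2 - (W (nabla U psi2 (u, t))).2)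
  (fun u => (nabla U psi1 (u, t)).1 - (nabla U psi2 (u, t)).1)
  (fun u => (nabla U psi1 (u, t)).2 - (nabla U psi2 (u, t)).2) d1 d2 U_compact).
- exact: smooth_boundary_null.
- by move=> u [Uu nUu]; exact: gap_boundary.
- exact: (S _ gap_continuous).
- exact: (S _ gap_t_continuous).
- exact: (S _ (within_continuousB a1 b1)).
- exact: (S _ (within_continuousB a2 b2)).
- exact: (S _ (within_continuousB f1 g1)).
- exact: (S _ (within_continuousB f2 g2)).
- by move=> u Uu; exact: (is_derive_sub (grad _ psi1_solution u Uu).1 (grad _
    psi2_solution u Uu).1).
- by move=> u Uu; exact: (is_derive_sub (grad _ psi1_solution u Uu).2 (grad _
    psi2_solution u Uu).2).
- by move=> u Uu; exact: (is_derive_sub (flux _ psi1_solution u Uu).1 (flux _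
    psi2_solution u Uu).1).
- by move=> u Uu; exact: (is_derive_sub (flux _ psi1_solution u Uu).2 (flux _
    psi2_solution u Uu).2).
- by move=> u Uu; exact: (cvgB (cflux _ psi1_solution u Uu).1 (cflux _ psi2_solution u
    Uu).1).
- by move=> u Uu; exact: (cvgB (cflux _ psi1_solution u Uu).2 (cflux _ psi2_solution u
    Uu).2).
(* The only use of the equation here: in the interior [gap_t] is the divergence of the difference of
   the fluxes. *)
- move=> u /Qi Qz; rewrite /gap_t !(derive_on_ext U_domain dir_t (solution_C1 _)).2//.
  rewrite (time_derivative_flux psi1_solution Qz) (time_derivative_flux psi2_solution Qz).
  by rewrite opprD addrACA.
Qed.

Lemma within_gap_mul : {within Q, continuous (fun z => gap z * gap_t z)}.
Proof. by apply: within_continuousM; [exact: gap_continuous|exact: gap_t_continuous]. Qed.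

Lemma gap_identity (t : R) : 0 <= t ->
  plane_integral U (fun u => gap (u, t) * gap_t (u, t)) =
  - plane_integral U (fun u => gap_pairing (u, t)).
Proof.
(* The equation is only assumed for [t > 0]; at [t = 0] both sides are limits. *)
rewrite le_eqVlt => /predU1P[<-|]; last exact: gap_integration_by_parts.
have c1 := plane_integral_continuous U_compact within_gap_mul.
have c2 := plane_integral_continuous U_compact gap_pairing_continuous.
have at0 (f : R -> R) : {within [set` `[(0 : R), +oo[], continuous f} -> f x @[x -->
  0^'+] --> f 0.
  move=> /subspace_continuousP/(_ 0) cf.
  have {}cf : f x @[x --> within [set` `[(0 : R), +oo[] (nbhs 0)] --> f 0.
    by apply: cf; rewrite /= in_itv/= lexx.
  have sub (P : set R) : within [set` `[(0 : R), +oo[] (nbhs 0) P -> 0^'+ P.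
    by rewrite /at_right /within/= => H; apply: filterS H => y h y0; apply: h;
      rewrite in_itv/= andbT ltW.
  by move=> C nC; apply: sub; exact: cf nC.
have l1 := at0 _ c1.
have l2 : - plane_integral U (fun u => gap_pairing (u, t)) @[t --> 0^'+] -->
    - plane_integral U (fun u => gap_pairing (u, 0)) by apply: cvgN; exact: at0.
apply: (cvg_unique _ l1); first exact: norm_hausdorff.
apply: cvg_trans l2; apply: near_eq_cvg.
near=> s; rewrite gap_integration_by_parts//; near: s; exact: nbhs_right_gt.
Unshelve. all: by end_near. Qed.

Lemma sqr_gap_continuous : {within Q, continuous (fun z => gap z ^+ 2)}.
Proof.
have := within_continuousM gap_continuous gap_continuous.
by apply: within_continuous_eq => z _; rewrite expr2.
Qed.

Lemma L2sq_derivative (t : R) : 0 <= t ->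
  derivative_within [set` `[0, +oo[] (L2sq U psi1 psi2) t
    (- 2 * plane_integral U (fun u => gap_pairing (u, t))).
Proof.
move=> t0.
have ce : {within Q, continuous (fun z => 2 * (gap z * gap_t z))}.
  by apply: within_continuousM within_gap_mul; exact/continuous_subspaceT/cst_continuous.
have := derivative_plane_integral U_compact sqr_gap_continuous ce is_derive_sqr_gap t0.
rewrite /plane_integral RintegralZl; last 2 first.
- exact: compact_measurable_plane.
- apply: within_continuous_integrable_plane => //.
  exact: within_spacetime_slice within_gap_mul.
have := gap_identity t0; rewrite /plane_integral => ->.
by rewrite mulrN mulNr.
Qed.

Lemma dissipation_le0 (t : R) : 0 <= t ->
  - 2 * plane_integral U (fun u => gap_pairing (u, t)) <= 0.
Proof.
move=> t0; rewrite mulNr oppr_le0 mulr_ge0//; apply: Rintegral_ge0 => u Uu.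
by apply: W_monotone; [apply: (solution_slope psi1_solution)|apply:
  (solution_slope psi2_solution)];
  exact/spacetimeP.
Qed.

Lemma L2dist_nonincreasing (s t : R) : 0 <= s -> s <= t ->
  L2dist U psi1 psi2 t <= L2dist U psi1 psi2 s.
Proof.
move=> s0 st; apply: ler_wsqrtr.
have cL : {within [set` `[(0 : R), +oo[], continuous (L2sq U psi1 psi2)}.
  exact: (plane_integral_continuous U_compact sqr_gap_continuous).
have [||c] := @MVT_segment R (L2sq U psi1 psi2)
    (fun t => - 2 * plane_integral U (fun u => gap_pairing (u, t))) s t st.
- move=> r; rewrite in_itv/= => /andP[sr _].
  have r0 := le_lt_trans s0 sr.
  apply: derivative_within_is_derive (L2sq_derivative (ltW r0)).
  (* For [r > 0] the half-line is a neighbourhood of [r], so the derivative within it is two-sided,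
     as the mean value theorem requires. *)
  by apply: filterS (lt_nbhsr r0) => y; rewrite /= in_itv/= andbT; exact: ltW.
- apply: continuous_subspaceW cL => r; rewrite /= !in_itv/= => /andP[sr _].
  by rewrite andbT (le_trans s0).
rewrite in_itv/= => /andP[sc _] E.
rewrite -subr_le0 E mulr_le0_ge0 ?subr_ge0//.
exact: dissipation_le0 (le_trans s0 sc).
Qed.

End Contraction.

Lemma closed_domain_closed (T : topologicalType) (U : set T) :
  closed_domain U -> closed U.
Proof. by move=> [G [_ _ _ ->]]; exact: closed_closure. Qed.

Theorem mainTheorem3 (R : realType) (U : set (R * R))
    (g : R * R -> R) (psi1 psi2 : (R * R) * R -> R)
    (U_bounded : bounded_set U)
    (U_domain : closed_domain U)
    (U_simply_connected : simply_connected_set (R := R) U)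
    (U_smooth : smooth_boundary U)
    (psi1_solution : solution U psi1)
    (psi2_solution : solution U psi2)
    (psi1_boundary : forall (u : R * R) (t : R), (U `\` U°) u -> 0 <= t -> psi1 (u, t) = g u)
    (psi2_boundary : forall (u : R * R) (t : R), (U `\` U°) u -> 0 <= t -> psi2 (u, t) = g u) :
  (forall t : R, 0 <= t ->
     let dissipation := - 2 * plane_integral U (fun u =>
       dotp (nabla U psi1 (u, t) - nabla U psi2 (u, t))
            (W (nabla U psi1 (u, t)) - W (nabla U psi2 (u, t)))) in
     derivative_within [set` `[0, +oo[] (L2sq U psi1 psi2) t dissipation /\
     dissipation <= 0) /\
  (forall s t : R, 0 <= s -> s <= t ->
     L2dist U psi1 psi2 t <= L2dist U psi1 psi2 s).
Proof.
have U_compact : compact U.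
  by apply: bounded_closed_compact_plane => //; exact: closed_domain_closed.
have psi_boundary (u : R * R) (t : R) : (U `\` U°) u -> 0 <= t ->
    psi1 (u, t) = psi2 (u, t).
  by move=> Uu t0; rewrite psi1_boundary ?psi2_boundary.
split=> [t t0 /=|s t s0 st]; last exact: L2dist_nonincreasing.
by split; [exact: L2sq_derivative|exact: dissipation_le0].
Qed.
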